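(* For every $n\geq2$, $\varepsilon>0$ and $0<l<\pi/n$, there exists a compact connected $n$-dimensional Riemannian spin manifold $(M,g)$ with non-empty boundary and a smooth area non-increasing map $\Phi\colon M\to S^n$ to the round unit sphere, locally constant near $\partial M$ and of non-zero degree, such that (i) $\mathrm{scal}_g=n(n-1)$; (ii) $H_g=-\tan(nl/2)$ on $\partial M$; (iii) $\mathrm{dist}_g(\mathrm{supp}(\mathrm{d}\Phi),\partial M)\geq l-\varepsilon$.
   Context: $\mathrm{scal}_g$ is the scalar curvature. $H_g$ is the normalized mean curvature of $\partial M$: with $\eta$ the inward pointing unit normal field, $H_g=\frac{1}{n-1}\mathrm{tr}(-\nabla\eta)$ (so the boundary of the Euclidean unit ball has $H=1$). For a smooth map $\Phi\colon M\to N$ of Riemannian manifolds, the area contraction constant at $p\in M$ is the norm of the induced map $\Phi_*\colon\Lambda^2T_pM\to\Lambda^2T_{\Phi(p)}N$; $\Phi$ is area non-increasing if this constant is $\leq 1$ at every point. If $M$ is compact, connected and oriented with boundary and $\Phi\colon M\to S^n$ ($n\ge2$) is smooth and locally constant near $\partial M$, then $\deg(\Phi)\in\mathbb{Z}$ is defined by counting with signs the preimages of a regular value not in the finite set $\Phi(\partial M)$. *)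

(* Defs.v *)
From HB Require Import structures.
From mathcomp Require Import all_boot all_order all_algebra.
From mathcomp Require Import all_classical all_reals all_analysis.

Set Implicit Arguments.
Unset Strict Implicit.
Unset Printing Implicit Defensive.

Import Order.TTheory GRing.Theory Num.Theory.
Import numFieldNormedType.Exports.

Local Open Scope classical_set_scope.
Local Open Scope ring_scope.

(* Tangent vectors are row vectors of coordinates and act on matrices from the
   left: a Gram matrix G gives the inner product v *m G *m w^T, and a Jacobian
   J (rows indexed by the source coordinates) maps v to v *m J.               *)

Section Calculus.
Variable R : realType.

(* The derivative is taken from the right because charts take values in the
   half space where the coordinate of index 0 is nonnegative, so that the
   quotient only involves points of the half space.  For a function that is
   smooth up to the boundary this is the usual partial derivative.            *)
Definition pd n (a : 'I_n) (f : 'rV[R]_n -> R) (x : 'rV[R]_n) : R :=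
  lim ((h^-1 * (f (x + h *: delta_mx 0 a) - f x)) @[h --> 0^'+]).

Definition jac m n (f : 'rV[R]_m -> 'rV[R]_n) (x : 'rV[R]_m) : 'M[R]_(m, n) :=
  \matrix_(a, b) pd a (fun y => f y 0 b) x.

(* C^k on U, for U open in a finite-dimensional V. *)
Fixpoint Ck (V : normedModType R) (k : nat) (U : set V) (f : V -> R) : Prop :=
  (forall x, U x -> {for x, continuous f}) /\
  match k with
  | 0%N => True
  | k'.+1 => forall v, (forall x, U x -> derivable f x v) /\ Ck k' U ('D_v f)
  end.

(* Smoothness on an arbitrary subset: local extendability to smooth functions
   on open sets.                                                              *)
Definition smooth_on (V : normedModType R) (A : set V) (f : V -> R) : Prop :=
  forall x, A x -> exists (U : set V) (F : V -> R),
    [/\ open U, U x, (forall k, Ck k U F) & forall y, A y -> U y -> f y = F y].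

Definition half_space n : set 'rV[R]_n :=
  [set x | forall a : 'I_n, val a = 0%N -> 0 <= x 0 a].

Definition dot n (u v : 'rV[R]_n) : R := (u *m v^T) 0 0.

End Calculus.

Section CoordinateGeometry.
Variables (R : realType) (n : nat).
Variable G : 'rV[R]_n -> 'M[R]_n.

Definition christoffel (k i j : 'I_n) (x : 'rV[R]_n) : R :=
  2^-1 * \sum_(m < n) invmx (G x) k m *
    (pd i (fun y => G y j m) x + pd j (fun y => G y i m) x
     - pd m (fun y => G y i j) x).

Definition ricci (i j : 'I_n) (x : 'rV[R]_n) : R :=
  \sum_(k < n) (pd k (christoffel k i j) x - pd j (christoffel k i k) x)
  + \sum_(k < n) \sum_(m < n)
      (christoffel k k m x * christoffel m i j x
       - christoffel k j m x * christoffel m i k x).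

Definition scal_coord (x : 'rV[R]_n) : R :=
  \sum_(i < n) \sum_(j < n) invmx (G x) i j * ricci i j x.

(* grad x_0 / |grad x_0|, the inward unit normal on {x_0 = 0}. *)
Definition inward_normal (x : 'rV[R]_n) : 'rV[R]_n :=
  let dx0 : 'rV[R]_n := \row_j ((val j == 0)%N)%:R in
  (Num.sqrt ((dx0 *m invmx (G x) *m dx0^T) 0 0))^-1 *: (dx0 *m invmx (G x)).

(* Coordinate b of nabla_{d_a} of the inward normal. *)
Definition nabla_normal (a b : 'I_n) (x : 'rV[R]_n) : R :=
  pd a (fun y => inward_normal y 0 b) x
  + \sum_(m < n) christoffel b a m x * inward_normal x 0 m.

(* For v tangent to {x_0 = 0}, nabla_v eta is tangent to {x_0 = 0} too; the
   trace of this endomorphism is taken in the basis d_a, a <> 0.              *)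
Definition mean_curvature_coord (x : 'rV[R]_n) : R :=
  (n.-1%:R)^-1 * \sum_(a < n | val a != 0%N) (- nabla_normal a a x).

End CoordinateGeometry.

(* Compact smooth n-manifold with (possibly empty) boundary.  chart_at selects
   a chart around each point; pointwise geometric quantities are computed in
   that chart, and do not depend on this choice.                              *)
Record cmanifold (R : realType) (n : nat) := CManifold {
  carrier :> topologicalType;
  chart_index : Type;
  dom : chart_index -> set carrier;
  chart : chart_index -> carrier -> 'rV[R]_n;
  chart_inv : chart_index -> 'rV[R]_n -> carrier;
  chart_at : carrier -> chart_index;
  dom_chart_at : forall p, dom (chart_at p) p;
  dom_open : forall i, open (dom i);
  chart_image : forall i, exists2 V : set 'rV[R]_n,
    open V & chart i @` dom i = @half_space R n `&` V;
  chartK : forall i p, dom i p -> chart_inv i (chart i p) = p;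
  chart_continuous : forall i p, dom i p -> {for p, continuous (chart i)};
  chart_inv_continuous : forall i,
    {within chart i @` dom i, continuous (chart_inv i)};
  transition_smooth : forall i j (b : 'I_n),
    smooth_on (chart i @` (dom i `&` dom j))
      (fun x => chart j (chart_inv i x) 0 b);
  carrier_hausdorff : hausdorff_space carrier;
  carrier_compact : compact [set: carrier]
}.

Section Manifold.
Variables (R : realType) (n : nat) (M : cmanifold R n).

Definition boundary : set M :=
  [set p | exists2 a : 'I_n, val a = 0%N & chart (chart_at p) p 0 a = 0].

Definition transition (i j : chart_index M) (p : M) : 'M[R]_n :=
  jac (fun x => chart j (chart_inv i x)) (chart i p).

Definition oriented : Prop :=
  forall i j (p : M), dom i p -> dom j p -> 0 < \det (transition i j p).

(* gram i p is the matrix of the metric at p in the coordinate frame of the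
   chart i; it is only meaningful for p in dom i.                             *)
Record metric := Metric {
  gram : chart_index M -> M -> 'M[R]_n;
  gram_sym : forall i p, dom i p -> (gram i p)^T = gram i p;
  gram_pos : forall i p (v : 'rV[R]_n), dom i p -> v != 0 ->
    0 < (v *m gram i p *m v^T) 0 0;
  gram_smooth : forall i (a b : 'I_n),
    smooth_on (chart i @` dom i) (fun x => gram i (chart_inv i x) a b);
  gram_transition : forall i j p, dom i p -> dom j p ->
    gram i p = transition i j p *m gram j p *m (transition i j p)^T
}.

End Manifold.

Arguments boundary {R n} M _.

Section Riemannian.
Variables (R : realType) (n : nat) (M : cmanifold R n) (g : metric M).

Definition scal (p : M) : R :=
  scal_coord (fun x => gram g (chart_at p) (chart_inv (chart_at p) x))
    (chart (chart_at p) p).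

Definition mean_curvature (p : M) : R :=
  mean_curvature_coord
    (fun x => gram g (chart_at p) (chart_inv (chart_at p) x))
    (chart (chart_at p) p).

Definition smooth_curve (c : R -> M) : Prop :=
  {within `[0, 1], continuous c} /\
  forall i (b : 'I_n),
    smooth_on [set t : R | 0 <= t <= 1 /\ dom i (c t)]
      (fun t => chart i (c t) 0 b).

Definition speed (c : R -> M) (t : R) : R :=
  let i := chart_at (c t) in
  let v : 'rV[R]_n := \row_b derive1 (fun s : R => chart i (c s) 0 b) t in
  Num.sqrt ((v *m gram g i (c t) *m v^T) 0 0).

Definition curve_length (c : R -> M) : \bar R :=
  (\int[lebesgue_measure]_(t in `]0%R, 1%R[) (speed c t)%:E)%E.

(* L is the length of a piecewise smooth curve from p to q. *)
Inductive joined : M -> M -> \bar R -> Prop :=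
| joined_smooth c : smooth_curve c -> joined (c 0) (c 1) (curve_length c)
| joined_cat p q r L1 L2 :
    joined p q L1 -> joined q r L2 -> joined p r (L1 + L2)%E.

Definition dist (p q : M) : \bar R := ereal_inf [set L | joined p q L].

Definition dist_set (A B : set M) : \bar R :=
  ereal_inf [set d | exists p q, [/\ A p, B q & d = dist p q]].

End Riemannian.

(* The round unit sphere S^n is the set of unit vectors of R^(n+1) with the
   induced metric, so that T_y S^n is a subspace of R^(n+1) with its dot
   product, and a map to S^n is smooth iff it is smooth as a map to R^(n+1).  *)
Section SphereMaps.
Variables (R : realType) (n : nat) (M : cmanifold R n).
Variable Phi : M -> 'rV[R]_n.+1.

Definition smooth_sphere_map : Prop :=
  (forall p, dot (Phi p) (Phi p) = 1) /\
  forall i (b : 'I_n.+1),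
    smooth_on (chart i @` dom i) (fun x => Phi (chart_inv i x) 0 b).

Definition differential (p : M) : 'M[R]_(n, n.+1) :=
  jac (fun x => Phi (chart_inv (chart_at p) x)) (chart (chart_at p) p).

Definition supp_differential : set M :=
  closure [set p | differential p != 0].

Definition locally_constant_near_boundary : Prop :=
  exists U : set M, [/\ open U, boundary M `<=` U &
    forall p, U p -> \forall q \near p, Phi q = Phi p].

(* The antisymmetric matrix W stands for the bivector
   sum_(i < j) W_ij e_i /\ e_j, for a basis e with Gram matrix G.             *)
Definition bivector_norm m (G W : 'M[R]_m) : R :=
  Num.sqrt (2^-1 * \tr (W^T *m G *m W *m G)).

Definition bivector_map m k (D : 'M[R]_(m, k)) (W : 'M[R]_m) : 'M[R]_k :=
  D^T *m W *m D.

Definition area_contraction (g : metric M) (p : M) : \bar R :=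
  ereal_sup [set c | exists W : 'M[R]_n,
    [/\ W^T = - W, bivector_norm (gram g (chart_at p) p) W <= 1 &
        c = (bivector_norm 1%:M (bivector_map (differential p) W))%:E]].

Definition area_nonincreasing (g : metric M) : Prop :=
  forall p, (area_contraction g p <= 1)%E.

Definition regular_value (y : 'rV[R]_n.+1) : Prop :=
  dot y y = 1 /\ forall p, Phi p = y -> row_free (differential p).

(* Sign of d_p Phi : T_p M -> T_y S^n, y = Phi p, for an oriented atlas of M;
   a basis of T_y S^n is positive when it is so in R^(n+1) after putting the
   outward normal y in front.                                                 *)
Definition local_degree (p : M) : int :=
  sgz (\det (col_mx (Phi p) (differential p) : 'M[R]_n.+1)).

(* The count does not depend on the regular value y. *)
Definition has_degree (d : int) : Prop :=
  exists y, [/\ regular_value y, ~ (Phi @` boundary M) y &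
    d = \sum_(p \in Phi @^-1` [set y]) local_degree p].

End SphereMaps.

(* The Clifford algebra of R^n with v * v = - |v|^2: an element is the family
   of its coordinates in the basis e_A = e_(a1) ... e_(ak) indexed by the
   subsets A = {a1 < ... < ak}, and e_A * e_B = +/- e_(A symdiff B).          *)
Section Clifford.
Variables (R : realType) (n : nat).

Definition clifford := {ffun {set 'I_n} -> R}.

Definition symdiff (A B : {set 'I_n}) : {set 'I_n} :=
  ((A :\: B) :|: (B :\: A))%SET.

(* One sign for each transposition sorting e_A e_B, one for each square. *)
Definition clifford_sign (A B : {set 'I_n}) : R :=
  (-1) ^+ (#|[set ab : 'I_n * 'I_n |
               [&& ab.1 \in A, ab.2 \in B & (ab.2 < ab.1)%N]]%SET|
           + #|(A :&: B)%SET|).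

Definition cmul (x y : clifford) : clifford :=
  [ffun C => \sum_(A : {set 'I_n}) \sum_(B : {set 'I_n} | symdiff A B == C)
     clifford_sign A B * x A * y B].

Definition cone : clifford := [ffun A => ((A == finset.set0) : nat)%:R].

Definition cvec (v : 'rV[R]_n) : clifford :=
  [ffun A => \sum_(i < n | A == finset.set1 i) v 0 i].

Definition in_Spin (x : clifford) : Prop :=
  exists vs : seq 'rV[R]_n,
    [/\ ~~ odd (size vs), forall v, v \in vs -> dot v v = 1 &
        x = foldr cmul cone [seq cvec v | v <- vs]].

(* A is the image of x under the covering Spin(n) -> SO(n), which maps x to
   v |-> x v x^-1 (on column vectors).                                        *)
Definition Spin_lifts (x : clifford) (A : 'M[R]_n) : Prop :=
  in_Spin x /\ forall v, cmul x (cvec v) = cmul (cvec (v *m A^T)) x.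

End Clifford.

(* A spin structure on M (with an oriented atlas), given by transition
   functions: positively oriented orthonormal frames over an open cover of M,
   and a lift of their SO(n)-valued transition functions to a Spin(n)-valued
   cocycle.  The rows of frame k p are the coordinates of the frame vectors in
   the chart spin_chart k.                                                    *)
Record spin_structure (R : realType) (n : nat) (M : cmanifold R n)
    (g : metric M) := SpinStructure {
  spin_index : Type;
  spin_dom : spin_index -> set M;
  spin_chart : spin_index -> chart_index M;
  frame : spin_index -> M -> 'M[R]_n;
  spin_lift : spin_index -> spin_index -> M -> clifford R n;
  spin_cover : forall p, exists k, spin_dom k p;
  spin_dom_open : forall k, open (spin_dom k);
  spin_dom_sub : forall k, spin_dom k `<=` dom (spin_chart k);
  frame_continuous : forall k p, spin_dom k p -> {for p, continuous (frame k)};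
  frame_orthonormal : forall k p, spin_dom k p ->
    frame k p *m gram g (spin_chart k) p *m (frame k p)^T = 1%:M;
  frame_positive : forall k p, spin_dom k p -> 0 < \det (frame k p);
  spin_lift_continuous : forall k k' (A : {set 'I_n}) p,
    spin_dom k p -> spin_dom k' p ->
    {for p, continuous (fun q => spin_lift k k' q A)};
  spin_lifts : forall k k' p, spin_dom k p -> spin_dom k' p ->
    Spin_lifts (spin_lift k k' p)
      (frame k p *m transition (spin_chart k) (spin_chart k') p
       *m invmx (frame k' p));
  spin_cocycle : forall k k' k'' p,
    spin_dom k p -> spin_dom k' p -> spin_dom k'' p ->
    cmul (spin_lift k k' p) (spin_lift k' k'' p) = spin_lift k k'' p
}.

(* Main.v *)
Require Import Defs.
From HB Require Import structures.
From mathcomp Require Import all_boot all_order all_algebra.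
From mathcomp Require Import all_classical all_reals all_analysis.
From mathcomp Require Import ring lra.

(** The manifold is the band M = T^(n-1) x [-l, l], a long neck whose two ends
    form the boundary, with a warped product metric dt^2 + w(t) |dx|^2 over a
    flat torus.  Write h = w' / (2 w).  The scalar curvature of such a metric is
    - 2 (n - 1) h' - n (n - 1) h^2 and the mean curvature of the end t = l is
    h(l), so that both only depend on h.  For h = - tan (n t / 2), that is
    w = C cos (n t / 2)^(4/n), the Riccati equation h' = - (n/2) (1 + h^2) turns
    the scalar curvature into n (n - 1), and the mean curvature of the two ends
    is - tan (n l / 2).  The constant C > 0, the size of the torus, remains free.

    Take any smooth map from M to S^n of non-zero degree which is constant on
    each of the two parts |t| >= delta.  Each coordinate plane of M contains a
    direction of the torus, so the area contraction of the map is of order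
    C^(-1/2) and it becomes area non-increasing for large C, however small delta
    is: lengths in the t direction may be expanded, areas are not
    ([bivector_map_contraction], [differential_bounded], [profile_large]).  As
    the 1-form dt has norm 1, the distance of two points is at least the
    difference of their values of t ([height_le_joined]), hence that of the
    support of the differential to the boundary is at least l - delta
    ([supp_differential_height], [dist_set_height]).

    Such a map is given by a formula.  Let W be the map from M to R^n whose
    components are t + l sum_i (1 - cos x_i) and the sin x_i.  It only vanishes
    at t = 0, x = 0: at any other zero of all the sines, some 1 - cos x_i is 2
    and the first component is at least l.  Let b(t) be a bump function with
    support in |t| <= delta.  The inverse stereographic projection of W / b,
    which is (b^2 - |W|^2, 2 b W) / (b^2 + |W|^2), is smooth, is equal to - e_0
    where b vanishes, and takes the value e_0 at the single zero of W, where its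
    differential is invertible ([sphere_map_degree]).

    The torus is realized by the points (cos x_i, sin x_i) of circles.  Charts
    use the angles around the points of angle 0 or pi of each circle, and the
    distance to one of the two ends of the interval.  Changes of charts are
    locally translations composed with reflections of the axes 0 and 1
    ([band_transition_near]); the normalized coordinate fields then make up a
    global frame, which orients M and trivializes its spin structure. *)

Set Implicit Arguments.
Unset Strict Implicit.
Unset Printing Implicit Defensive.

Import Order.TTheory GRing.Theory Num.Theory.
Import numFieldNormedType.Exports.

Local Open Scope classical_set_scope.
Local Open Scope ring_scope.

(** * Continuity *)

Lemma cvg_mx (T : Type) (F : set_system T) {FF : Filter F} (X : topologicalType)
    p q (f : T -> 'M[X]_(p, q)) (M : 'M[X]_(p, q)) :
  (forall i j, f x i j @[x --> F] --> M i j) -> f x @[x --> F] --> M.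
Proof.
move=> fM A [P PM PA]; rewrite nbhs_filterE /=.
have : F [set x | forall i j, P i j (f x i j)].
  by apply: filter_forall => i; apply: filter_forall => j; exact: fM.
by apply: filterS => x /PA.
Qed.

Lemma continuous_mulc (R : realType) (T : topologicalType) (c : R) (f : T -> R)
  (p : T) : {for p, continuous f} -> {for p, continuous (fun q => c * f q)}.
Proof. by move=> cf; apply: cvgM => //; exact: cvg_cst. Qed.

(** * Functions of class C^k *)

Section CkTheory.
Context {R : realType} {V : normedModType R}.
Implicit Types (U : set V) (f g : V -> R).

Lemma Ck_ext k U f g : open U -> (forall x, U x -> f x = g x) ->
  Ck k U f -> Ck k U g.
Proof.
move=> oU; elim: k f g => [|k IH] f g fg /= [cf Df].
all: have nfg x : U x -> \forall y \near x, f y = g y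
  by move=> Ux; near=> y; apply: fg; near: y; exact: open_nbhs_nbhs.
all: have cfg x : U x -> {for x, continuous g}
  by move=> Ux; rewrite /prop_for /continuous_at -(fg _ Ux);
     apply: cvg_trans (cf _ Ux); apply: near_eq_cvg; exact: nfg.
all: split.
- exact: cfg.
- by [].
- exact: cfg.
- move=> v; have [df Cf] := Df v; split=> [x Ux|].
    by apply: near_eq_derivable (nfg x Ux) _; exact: df.
  by apply: IH Cf => x Ux; exact: near_eq_derive (nfg x Ux).
Unshelve. all: by end_near. Qed.

Lemma Ck_sub k U U' f : U' `<=` U -> Ck k U f -> Ck k U' f.
Proof.
move=> sU; elim: k f => [|k IH] f /= [cf Df]; split=> //.
- by move=> x /sU /cf.
- by move=> x /sU /cf.
- move=> v; have [df Cf] := Df v; split; last exact: IH.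
  by move=> x /sU /df.
Qed.

Lemma CkS k U f : Ck k.+1 U f -> Ck k U f.
Proof.
elim: k f => [|k IH] f /= [cf Df]; split=> //.
by move=> v; have [df Cf] := Df v; split=> //; exact: IH.
Qed.

Lemma Ck_cont k U f x : Ck k U f -> U x -> {for x, continuous f}.
Proof. by case: k => [|k] [cf _] /cf. Qed.

Lemma Ck_derivable U f x v : (forall k, Ck k U f) -> U x -> derivable f x v.
Proof. by move=> /(_ 1%N) [_ /(_ v)[df _]] /df. Qed.

Lemma Ck_derive U f v : (forall k, Ck k U f) -> forall k, Ck k U ('D_v f).
Proof. by move=> Cf k; have [_ /(_ v)[]] := Cf k.+1. Qed.

Lemma Ck_cst k U a : Ck k U (cst a).
Proof.
elim: k a => [|k IH] a /=; split=> //.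
- by move=> x _; exact: cvg_cst.
- by move=> x _; exact: cvg_cst.
- move=> v; split=> [x _|]; first exact: derivable_cst.
  suff -> : 'D_v (cst a : V -> R) = cst 0 by exact: IH.
  by apply/funext => x; rewrite derive_cst.
Qed.

Lemma Ck_add k U f g : open U -> Ck k U f -> Ck k U g ->
  Ck k U (fun x => f x + g x).
Proof.
move=> oU; elim: k f g => [|k IH] f g /= [cf Df] [cg Dg]; split=> //.
- by move=> x Ux; apply: cvgD; [exact: cf|exact: cg].
- by move=> x Ux; apply: cvgD; [exact: cf|exact: cg].
- move=> v; have [df Cf] := Df v; have [dg Cg] := Dg v; split=> [x Ux|].
    by apply: derivableD; [exact: df|exact: dg].
  apply: (Ck_ext oU _ (IH _ _ Cf Cg)) => x Ux.
  by rewrite -deriveD //; [exact: df|exact: dg].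
Qed.

Lemma Ck_mul k U f g : open U -> Ck k U f -> Ck k U g ->
  Ck k U (fun x => f x * g x).
Proof.
move=> oU; elim: k f g => [|k IH] f g.
  by move=> [cf _] [cg _]; split=> // x Ux; apply: cvgM; [exact: cf|exact: cg].
move=> Ckf Ckg; have Cf0 := CkS Ckf; have Cg0 := CkS Ckg.
move: Ckf Ckg => [cf Df] [cg Dg]; split=> //.
  by move=> x Ux; apply: cvgM; [exact: cf|exact: cg].
move=> v; have [df Cf] := Df v; have [dg Cg] := Dg v; split=> [x Ux|].
  by apply: derivableM; [exact: df|exact: dg].
apply: (Ck_ext oU _ (Ck_add oU (IH _ _ Cf0 Cg) (IH _ _ Cg0 Cf))) => x Ux.
by rewrite deriveM //; [exact: df|exact: dg].
Qed.

Lemma Ck_opp k U f : open U -> Ck k U f -> Ck k U (fun x => - f x).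
Proof.
move=> oU Cf; apply: (Ck_ext oU _ (Ck_mul oU (Ck_cst k U (-1)) Cf)) => x _.
by rewrite mulN1r.
Qed.

Lemma Ck_sub_fun k U f g : open U -> Ck k U f -> Ck k U g ->
  Ck k U (fun x => f x - g x).
Proof. by move=> oU Cf Cg; apply: Ck_add => //; exact: Ck_opp. Qed.

Lemma Ck_sum k U (I : Type) (r : seq I) (P : pred I) (F : I -> V -> R) :
  open U -> (forall i, P i -> Ck k U (F i)) ->
  Ck k U (fun x => \sum_(i <- r | P i) F i x).
Proof.
move=> oU CF; elim: r => [|i r IH].
  by apply: (Ck_ext oU _ (Ck_cst k U 0)) => x _; rewrite big_nil.
case: (boolP (P i)) => Pi.
  apply: (Ck_ext oU _ (Ck_add oU (CF i Pi) IH)) => x _.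
  by rewrite big_cons Pi.
by apply: (Ck_ext oU _ IH) => x _; rewrite big_cons (negPf Pi).
Qed.

End CkTheory.

Section CkAffine.
Context {R : realType} {V W : normedModType R}.

(** The difference quotients of f o A in the direction v are those of f in the
    direction L v, where L is the linear part of A: no chain rule is involved,
    and differentiability in one direction is enough. *)
Lemma derive_affine (A L : V -> W) (f : W -> R) x v :
  (forall h : R, A (h *: v + x) = h *: L v + A x) ->
  (derivable (f \o A) x v <-> derivable f (A x) (L v)) /\
  'D_v (f \o A) x = 'D_(L v) f (A x).
Proof.
move=> AL.
have E : (fun h : R => h^-1 *: ((f \o A \o shift x) (h *: v) - (f \o A) x))
     = (fun h : R => h^-1 *: ((f \o shift (A x)) (h *: L v) - f (A x))).
  by apply/funext => h /=; rewrite AL.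
by rewrite /derivable /derive E.
Qed.

Lemma Ck_affine k (A L : V -> W) (f : W -> R) (U : set W) :
  continuous A -> (forall x v (h : R), A (h *: v + x) = h *: L v + A x) ->
  Ck k U f -> Ck k (A @^-1` U) (f \o A).
Proof.
move=> cA AL; elim: k f => [|k IH] f /= [cf Df].
  split=> // x Ux; apply: continuous_comp; first exact: cA.
  exact: cf.
split=> [x Ux|v]; first by apply: continuous_comp; [exact: cA|exact: cf].
have [df Cf] := Df (L v); split=> [x Ux|].
  by apply/(proj1 (derive_affine f (AL x v))); exact: df.
suff -> : 'D_v (f \o A) = 'D_(L v) f \o A by exact: IH.
by apply/funext => x; rewrite (proj2 (derive_affine f (AL x v))).
Qed.

End CkAffine.

Section Smooth1.
Context {R : realType}.

(** C^k regularity of a function of one real variable in terms of a chosen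
    derivative; this form makes the chain rule below an easy induction. *)
Fixpoint Ck1 (k : nat) (I : set R) (g : R -> R) : Prop :=
  match k with
  | 0%N => forall x, I x -> {for x, continuous g}
  | k'.+1 => exists2 g', (forall x, I x -> is_derive x 1 g (g' x))
                         & Ck1 k' I g'
  end.

Lemma Ck1_cont k I g : Ck1 k I g -> forall x, I x -> {for x, continuous g}.
Proof.
case: k => [//|k] [g' dg _] x Ix.
by apply: differentiable_continuous; apply/derivable1_diffP; have [] := dg x Ix.
Qed.

(** On the line through x in the direction v, this is the chain rule for
    functions of one variable. *)
Lemma is_derive_comp1 (V : normedModType R) (f : V -> R) (g : R -> R) x v df dg :
  is_derive x v f df -> is_derive (f x) 1 g dg ->
  is_derive x v (g \o f) (df * dg).
Proof.
move=> [Hf Ef] [Hg Eg].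
pose A (t : R) : V := t *: v + x; pose L (h : R) : V := h *: v.
have AL (h : R) : A (h *: 1 + 0) = h *: L 1 + A 0.
  by rewrite /L /A addr0 scale0r add0r scale1r -[h *: 1]/(h * 1) mulr1.
have A0 : A 0 = x by rewrite /A scale0r add0r.
have L1 : L 1 = v by rewrite /L scale1r.
have [H1 E1] := @derive_affine R R V A L f 0 1 AL.
have [H2 E2] := @derive_affine R R V A L (g \o f) 0 1 AL.
rewrite A0 L1 in H1 E1 H2 E2.
have dF : is_derive (0 : R) 1 (f \o A) df.
  by split; [apply/H1|rewrite E1].
have dg0 : is_derive ((f \o A) 0) 1 g dg by rewrite /= A0; split.
have [D1 D2] := is_derive1_comp dg0 dF.
by split; [apply/H2|rewrite -E2 compA D2 mulrC].
Qed.

(** The derivative of g o f along v is the product of g' o f by that of f, and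
    the induction applies to g'. *)
Lemma Ck_comp1 (V : normedModType R) k (U : set V) (I : set R) f g : open U ->
  (forall x, U x -> I (f x)) -> Ck k U f -> Ck1 k I g -> Ck k U (g \o f).
Proof.
move=> oU UI; elim: k g => [|k IH] g.
  move=> [cf _] cg; split=> // x Ux.
  by apply: continuous_comp; [exact: cf|exact/cg/UI].
move=> Ckf; have Cf0 := CkS Ckf; case: Ckf => [cf Df] Cg.
split=> [x Ux|v].
  by apply: continuous_comp; [exact: cf|exact/(Ck1_cont Cg)/UI].
case: Cg => g' dg Cg'; have [df Cf] := Df v.
have H x : U x -> is_derive x v (g \o f) ('D_v f x * g' (f x)).
  move=> Ux; apply: is_derive_comp1; first exact/derivableP/df.
  exact/dg/UI.
split=> [x /H[]//|].
apply: (Ck_ext oU _ (Ck_mul oU Cf (IH _ Cf0 Cg'))) => x /H[_ ->] //.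
Qed.

Lemma Ck1_scale k I c g : Ck1 k I g -> Ck1 k I (fun x => c * g x).
Proof.
elim: k g => [|k IH] g.
  by move=> cg x Ix; apply: cvgM; [exact: cvg_cst|exact: cg].
move=> [g' dg Cg]; exists (fun x => c * g' x); last exact: IH.
by move=> x Ix; have dgx := dg x Ix; exact: (@is_deriveZ _ _ _ g c).
Qed.

Lemma Ck1_add k I f g : Ck1 k I f -> Ck1 k I g -> Ck1 k I (fun x => f x + g x).
Proof.
elim: k f g => [|k IH] f g.
  by move=> cf cg x Ix; apply: cvgD; [exact: cf|exact: cg].
move=> [f' df Cf] [g' dg Cg]; exists (fun x => f' x + g' x); last exact: IH.
by move=> x Ix; have dfx := df x Ix; have dgx := dg x Ix;
  exact: (@is_deriveD _ _ _ f g).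
Qed.

(** Smoothness of a function is obtained below from a family of functions which
    contains it and is closed under derivation: here the span of sin and cos. *)
Lemma is_derive_sincos (a b x : R) :
  is_derive x 1 (fun x => a * sin x + b * cos x) ((- b) * sin x + a * cos x).
Proof.
have H1 := @is_deriveZ _ _ _ _ a _ _ _ (is_derive_sin x).
have H2 := @is_deriveZ _ _ _ _ b _ _ _ (is_derive_cos x).
have H := @is_deriveD _ _ _ _ _ _ _ _ _ H1 H2.
by apply: is_derive_eq H _; rewrite /GRing.scale /=; ring.
Qed.

Lemma Ck1_sincos k (a b : R) : Ck1 k setT (fun x => a * sin x + b * cos x).
Proof.
elim: k a b => [|k IH] a b.
  move=> x _; apply: cvgD; apply: cvgM; try exact: cvg_cst.
    exact: continuous_sin.
  exact: continuous_cos.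
exists (fun x => (- b) * sin x + a * cos x) => // x _.
exact: is_derive_sincos.
Qed.

Lemma Ck1_sin k : Ck1 k setT (@sin R).
Proof.
have := Ck1_sincos k 1 0.
by rewrite (_ : (fun _ => _) = @sin R) //; apply/funext => x; ring.
Qed.

Lemma Ck1_cos k : Ck1 k setT (@cos R).
Proof.
have := Ck1_sincos k 0 1.
by rewrite (_ : (fun _ => _) = @cos R) //; apply/funext => x; ring.
Qed.

Lemma is_derive_invX m (x : R) : x != 0 ->
  is_derive x 1 (fun y : R => y^-1 ^+ m) (- m%:R * x^-1 ^+ m.+1).
Proof.
move=> x0; case: m => [|m].
  rewrite mulr0n oppr0 mul0r.
  have -> : (fun y : R => y^-1 ^+ 0) = cst 1 by apply/funext => y; rewrite expr0.
  exact: is_derive_cst.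
have H : is_derive x 1 (fun y : R => y^-1) (- x ^- 2 *: 1).
  exact: is_deriveV.
have := @is_deriveX _ _ _ m.+1 x 1 _ H; rewrite exprfctE => /is_derive_eq; apply.
by rewrite /GRing.scale /= mulr1 -[x ^- 2]exprVn /= -mulr_natl !exprS; ring.
Qed.

Lemma Ck1_invX k m : Ck1 k [set x : R | x != 0] (fun x : R => x^-1 ^+ m).
Proof.
elim: k m => [|k IH] m.
  move=> x /= x0; apply: differentiable_continuous; apply/derivable1_diffP.
  by have [] := is_derive_invX m x0.
exists (fun x => - m%:R * x^-1 ^+ m.+1); last exact: Ck1_scale.
by move=> x; exact: is_derive_invX.
Qed.

Lemma Ck1_inv k : Ck1 k [set x : R | x != 0] GRing.inv.
Proof. by have := Ck1_invX k 1. Qed.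

(** * A smooth function that is flat at the origin *)

(** The functions x^-m exp (-1/x), extended by 0 to the negative half line;
    the span of this family is stable under derivation. *)
Definition flat (m : nat) (x : R) : R :=
  if 0 < x then x^-1 ^+ m * expR (- x^-1) else 0.

(** By exp y >= y^(m+2) / (m+2)! for y = 1/x; such a bound for every m shows that
    the whole family has derivative 0 at 0. *)
Lemma flat_le m x : `|flat m x| <= (m.+2)`!%:R * x ^+ 2.
Proof.
rewrite /flat; case: ifPn => [x0|_]; last first.
  by rewrite normr0 mulr_ge0 ?sqr_ge0.
have y0 : 0 < x^-1 by rewrite invr_gt0.
rewrite ger0_norm; last by rewrite mulr_ge0 ?exprn_ge0 ?expR_ge0 // ltW.
have := expR_ge1Dxn m.+1 (ltW y0); rewrite expRN.
set e := expR _; set f := _%:R; set z := x^-1 in y0 *.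
move=> He; have e0 : 0 < e by exact: expR_gt0.
have f0 : 0 < f by rewrite ltr0n fact_gt0.
have {He} He : z ^+ m.+2 <= f * e.
  have H : z ^+ m.+2 / f <= e by lra.
  by rewrite mulrC -ler_pdivrMr.
have xz : x ^+ 2 = (z ^+ 2)^-1 by rewrite /z exprVn invrK.
rewrite ler_pdivrMr // xz -mulrA [_^-1 * e]mulrC mulrA.
by rewrite ler_pdivlMr ?exprn_gt0 // -exprD addn2.
Qed.

Lemma is_derive0_quad (f : R -> R) (C : R) :
  (forall x, `|f x| <= C * x ^+ 2) -> is_derive (0 : R) 1 f 0.
Proof.
move=> fC; have f0 : f 0 = 0.
  by have := fC 0; rewrite expr0n /= mulr0 normr_le0 => /eqP.
have C0 : 0 <= C.
  by have := fC 1; rewrite expr1n mulr1; apply: le_trans; rewrite normr_ge0.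
suff H : (fun h : R => h^-1 *: ((f \o shift 0) (h *: 1) - f 0)) @ 0^' --> (0:R).
  by split; [apply/cvg_ex; exists 0|exact: cvg_lim H].
apply/cvgrPdist_le => e e0; near=> h.
have h0 : h != 0 by near: h; exact: nbhs_dnbhs_neq.
rewrite sub0r normrN f0 subr0 /= addr0 /GRing.scale /= mulr1 normrM normfV.
rewrite mulrC ler_pdivrMr ?normr_gt0 //; apply: (le_trans (fC h)).
rewrite -real_normK ?num_real // expr2 mulrA ler_pM2r ?normr_gt0 //.
apply: (@le_trans _ _ ((C + 1) * `|h|)); first by rewrite ler_pM2r ?normr_gt0 // lerDl.
rewrite mulrC -ler_pdivlMr ?ltr_wpDl //; near: h; apply: dnbhs0_le.
by rewrite divr_gt0 // ltr_wpDl.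
Unshelve. all: by end_near. Qed.

Lemma is_derive_flat m (x : R) :
  is_derive x 1 (flat m) (flat m.+2 x + (- m%:R) * flat m.+1 x).
Proof.
have [x0|x0|->] := ltrgtP x 0.
- have -> : flat m.+2 x + - m%:R * flat m.+1 x = 0.
    by rewrite /flat ltNge ltW //= mulr0 addr0.
  apply: (@near_eq_is_derive R R R (cst 0)).
  near=> y; rewrite /flat ltNge ltW //=; near: y; exact: lt_nbhsl.
- have -> : flat m.+2 x + - m%:R * flat m.+1 x =
      x^-1 ^+ m.+2 * expR (- x^-1) - m%:R * (x^-1 ^+ m.+1 * expR (- x^-1)).
    by rewrite /flat x0 mulNr.
  apply: (@near_eq_is_derive R R R (fun y : R => y^-1 ^+ m * expR (- y^-1))).
    by near=> y; rewrite /flat ifT //; near: y; exact: lt_nbhsr.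
  have xn0 : x != 0 by rewrite gt_eqF.
  have H1 := is_derive_invX m xn0.
  have H3 : is_derive x 1 (fun y : R => - y^-1) (x^-1 ^+ 2).
    have H : is_derive x 1 (fun y : R => y^-1) (- x ^- 2 *: 1).
      exact: is_deriveV.
    have HN : is_derive x 1 (fun y : R => - y^-1) (- (- x ^- 2 *: 1)).
      exact: (@is_deriveN _ _ _ _ _ _ _ H).
    apply: is_derive_eq HN _.
    by rewrite /GRing.scale /= mulr1 opprK -exprVn.
  have H4 := @is_derive_comp1 R _ expR _ _ _ _ H3 (is_derive_expR (- x^-1)).
  apply: is_derive_eq (@is_deriveM _ _ _ _ _ _ _ _ H1 H4) _.
  by rewrite /GRing.scale /= !exprS; ring.
- have -> : flat m.+2 0 + - m%:R * flat m.+1 0 = 0.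
    by rewrite /flat ltxx mulr0 addr0.
  exact: is_derive0_quad (flat_le m).
Unshelve. all: by end_near. Qed.

Lemma Ck1_flat k m : Ck1 k setT (flat m).
Proof.
elim: k m => [|k IH] m.
  move=> x _; apply: differentiable_continuous; apply/derivable1_diffP.
  by have [] := is_derive_flat m x.
exists (fun x => flat m.+2 x + (- m%:R) * flat m.+1 x).
  by move=> x _; exact: is_derive_flat.
by apply: Ck1_add; [|apply: Ck1_scale]; exact: IH.
Qed.

Lemma flat_eq0 m x : x <= 0 -> flat m x = 0.
Proof. by rewrite /flat ltNge => ->. Qed.

Lemma flat_gt0 m x : 0 < x -> 0 < flat m x.
Proof. by move=> x0; rewrite /flat x0 mulr_gt0 ?exprn_gt0 ?expR_gt0 ?invr_gt0. Qed.

End Smooth1.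

(** * One-sided partial derivatives *)

Section PartialDerivatives.
Context {R : realType} {n : nat}.
Implicit Types (f F : 'rV[R]_n -> R) (x : 'rV[R]_n).

Lemma pd_ext a f g x :
  (\forall h \near (0 : R)^'+, f (x + h *: delta_mx 0 a) = g (x + h *: delta_mx 0 a)) ->
  f x = g x -> pd a f x = pd a g x.
Proof.
move=> fg fgx; rewrite /pd; congr (lim _).
have E : \forall h \near (0 : R)^'+, h^-1 * (f (x + h *: delta_mx 0 a) - f x) =
    h^-1 * (g (x + h *: delta_mx 0 a) - g x).
  by near=> h; rewrite fgx; congr (_ * (_ - _)); near: h.
rewrite eqEsubset; split; apply: near_eq_cvg; first exact: E.
by near=> h; apply/esym; near: h; exact: E.
Unshelve. all: by end_near. Qed.

Lemma pd_derive a F x :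
  derivable F x (delta_mx 0 a) -> pd a F x = 'D_(delta_mx 0 a) F x.
Proof.
move=> dF; pose e : 'rV[R]_n := delta_mx 0 a.
pose q (h : R) : R := h^-1 *: ((F \o shift x) (h *: e) - F x).
have Eq : (fun h : R => h^-1 * (F (x + h *: e) - F x)) = q.
  by apply/funext => h; rewrite /q /= [x + _]addrC.
by rewrite /pd Eq; apply/esym/cvg_at_rightE.
Qed.

Lemma is_derive_pd a F x d : is_derive x (delta_mx 0 a) F d -> pd a F x = d.
Proof. by move=> [dF <-]; exact: pd_derive. Qed.

Lemma is_derive_affine1 F x v (d : R) :
  (forall h : R, F (h *: v + x) = h * d + F x) -> is_derive x v F d.
Proof.
move=> FE; have AL (h : R) : F (h *: v + x) = h *: cst d v + F x by rewrite FE.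
have [H1 H2] := @derive_affine R 'rV[R]_n R F (cst d) id x v AL.
split; first by apply/H1; exact: derivable_id.
by rewrite -[LHS]/('D_v (id \o F) x) H2 derive_id.
Qed.

Lemma is_derive_coord (b : 'I_n) x (v : 'rV[R]_n) :
  is_derive x v (fun y : 'rV[R]_n => y 0 b) (v 0 b).
Proof. by apply: is_derive_affine1 => h; rewrite !mxE. Qed.

(** Reflecting a coordinate axis changes the sign of the partial derivative
    along it. *)
Lemma is_derive_scale F (c : R) x v (d : R) :
  is_derive x v F d -> is_derive x (c *: v) F (c * d).
Proof.
move=> [HF EF].
pose A (t : R) : 'rV[R]_n := t *: v + x; pose L (h : R) : 'rV[R]_n := h *: v.
have A0 : A 0 = x by rewrite /A scale0r add0r.
have [H1 E1] : (derivable (F \o A) (0 : R) 1 <-> derivable F (A 0) (L 1)) /\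
    'D_1 (F \o A) (0 : R) = 'D_(L 1) F (A 0).
  apply: (@derive_affine R R 'rV[R]_n A L F 0 1) => h.
  by rewrite /A /L addr0 !scale0r !add0r scale1r -[h *: 1]/(h * 1) mulr1.
have [H2 E2] : (derivable (F \o A) (0 : R) c <-> derivable F (A 0) (L c)) /\
    'D_c (F \o A) (0 : R) = 'D_(L c) F (A 0).
  apply: (@derive_affine R R 'rV[R]_n A L F 0 c) => h.
  by rewrite /A /L addr0 !scale0r !add0r -[h *: c]/(h * c) scalerA.
rewrite A0 /L scale1r in H1 E1; rewrite A0 /L in H2 E2.
have /derivable1_diffP dFA : derivable (F \o A) (0 : R) 1 by apply/H1.
split; first by apply/H2; exact: diff_derivable.
rewrite -E2 deriveE // -[X in 'd _ _ X]mulr1 -[X in 'd _ _ X]/(c *: 1).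
by rewrite linearZ /= -deriveE // E1 EF.
Qed.

End PartialDerivatives.

Lemma Ck_coord (R : realType) n (b : 'I_n) k :
  Ck k [set: 'rV[R]_n] (fun x : 'rV[R]_n => x 0 b).
Proof.
have cc : continuous (fun x : 'rV[R]_n => x 0 b) by exact: coord_continuous.
case: k => [|k]; (split; first by move=> x _; exact: cc) => //.
move=> v.
split=> [x _|]; first by have [] := is_derive_coord b x v.
have -> : 'D_v (fun x : 'rV[R]_n => x 0 b) = cst (v 0 b).
  by apply/funext => x; have [_ ->] := is_derive_coord b x v.
exact: Ck_cst.
Qed.

(** One-sided neighbourhoods: moving a little in a positive coordinate
    direction does not leave the set, so that the values of the operator [pd]
    on it only depend on the restriction of the function. *)
Definition right_open (R : realType) n (S : set 'rV[R]_n) :=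
  forall x a, S x -> \forall h \near (0 : R)^'+, S (x + h *: delta_mx 0 a).

Lemma pd_eq_on (R : realType) n (S : set 'rV[R]_n) f g a x :
  right_open S -> (forall y, S y -> f y = g y) -> S x -> pd a f x = pd a g x.
Proof.
move=> oS fg Sx; apply: pd_ext; last exact: fg.
by apply: filterS (oS x a Sx) => h; exact: fg.
Qed.

Lemma near_right_shift (R : realType) n (P : set 'rV[R]_n) (x : 'rV[R]_n) (a : 'I_n) :
  nbhs x P -> \forall h \near (0 : R)^'+, P (x + h *: delta_mx 0 a).
Proof.
move=> Px; have cA : (fun h : R => x + h *: (delta_mx 0 a : 'rV[R]_n)) @ (0 : R)
    --> x.
  rewrite -[X in _ --> X]addr0 -[X in _ + X](scale0r (delta_mx 0 a)).
  apply: cvgD; first exact: cvg_cst.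
  exact: (@scalel_continuous R 'rV[R]_n).
exact: (cvg_at_right_filter cA).
Qed.

Lemma right_open_half_space (R : realType) n (V : set 'rV[R]_n) :
  open V -> right_open (@half_space R n `&` V).
Proof.
move=> oV x a [Hx Vx]; apply: filterI; near=> h.
  move=> b /Hx xb; rewrite !mxE addr_ge0 // mulr_ge0 //.
by near: h; apply: near_right_shift; apply: open_nbhs_nbhs.
Unshelve. all: by end_near. Qed.

(** * Curvature of a warped product metric *)

Section WarpedProduct.
Context {R : realType} {n : nat}.
Implicit Types (i j k a : 'I_n.+1) (x : 'rV[R]_n.+1).

Definition warped_gram (w : R) : 'M[R]_n.+1 :=
  diag_mx (\row_i (if i == 0 then 1 else w)).

Lemma warped_gramE (w : R) i j :
  warped_gram w i j = if i == j then (if i == 0 then 1 else w) else 0.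
Proof. by rewrite !mxE; case: (i == j); rewrite ?mulr1n ?mulr0n. Qed.

Lemma invmx_warped (w : R) : w != 0 -> invmx (warped_gram w) = warped_gram w^-1.
Proof.
move=> w0; have E : warped_gram w *m warped_gram w^-1 = 1%:M.
  rewrite mulmx_diag -diag_const_mx; congr diag_mx; apply/rowP => i.
  by rewrite !mxE; case: ifP => _; rewrite ?mulr1 ?mulfV.
have [uw _] := mulmx1_unit E.
by rewrite -[LHS]mulmx1 -E mulmxA mulVmx // mul1mx.
Qed.

(** The only non zero Christoffel symbols of dt^2 + w(t) |dx|^2, for i <> 0, are
    Gamma^0_ii = A and Gamma^i_0i = Gamma^i_i0 = B, with A = - w'/2 and
    B = w'/(2w). *)
Definition warped_christoffel (A B : R) k i j : R :=
  if k == 0 then (if (i == j) && (i != 0) then A else 0) else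
  if i == 0 then (if j == k then B else 0) else
  if j == 0 then (if i == k then B else 0) else 0.

Lemma sum_ord0 (F : 'I_n.+1 -> R) :
  \sum_k F k = F 0 + \sum_(k < n) F (lift 0 k).
Proof. by rewrite big_ord_recl. Qed.

Lemma sum_const_ord (c : R) : \sum_(k < n) c = n%:R * c.
Proof. by rewrite sumr_const card_ord mulr_natl. Qed.

Lemma sum_if_eq (i : 'I_n) (c : R) :
  (\sum_(k < n) (if k == i then c else 0) = c) *
  (\sum_(k < n) (if i == k then c else 0) = c).
Proof.
have E : \sum_(k < n) (if k == i then c else 0) = c.
  by rewrite -big_mkcond big_pred1_eq.
by split=> //; rewrite -[RHS]E; apply: eq_bigr => k _; rewrite eq_sym.
Qed.

Lemma warped_christoffelE (A B : R) :
  (warped_christoffel A B 0 0 0 = 0) *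
  (forall j : 'I_n, warped_christoffel A B 0 0 (lift 0 j) = 0) *
  (forall i : 'I_n, warped_christoffel A B 0 (lift 0 i) 0 = 0) *
  (forall i j : 'I_n, warped_christoffel A B 0 (lift 0 i) (lift 0 j) =
     if i == j then A else 0) *
  (forall k : 'I_n, warped_christoffel A B (lift 0 k) 0 0 = 0) *
  (forall k j : 'I_n, warped_christoffel A B (lift 0 k) 0 (lift 0 j) =
     if j == k then B else 0) *
  (forall k i : 'I_n, warped_christoffel A B (lift 0 k) (lift 0 i) 0 =
     if i == k then B else 0) *
  (forall k i j : 'I_n,
     warped_christoffel A B (lift 0 k) (lift 0 i) (lift 0 j) = 0).
Proof.
have l0 (k : 'I_n) : (lift 0 k == 0) = false by [].
have ll (k j : 'I_n) : (lift 0 k == lift 0 j) = (k == j).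
  by rewrite (inj_eq lift_inj).
by do !split => *; rewrite /warped_christoffel ?eqxx ?l0 ?ll ?andbT ?andbF //=;
  case: ifP.
Qed.

(** S stands for the image of a chart: a metric is only controlled there. *)
Variables (G : 'rV[R]_n.+1 -> 'M[R]_n.+1) (S : set 'rV[R]_n.+1).
Variables (w h h' : R -> R).
Hypothesis S_open : right_open S.
Hypothesis GE : forall x, S x -> G x = warped_gram (w (x 0 0)).
Hypothesis w_neq0 : forall x, S x -> w (x 0 0) != 0.
Hypothesis dw : forall x, S x ->
  is_derive (x 0 0) 1 w (2 * h (x 0 0) * w (x 0 0)).
Hypothesis dh : forall x, S x -> is_derive (x 0 0) 1 h (h' (x 0 0)).

Lemma pd_fun0 (phi : R -> R) d a x :
  is_derive (x 0 0) 1 phi d ->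
  pd a (fun y : 'rV[R]_n.+1 => phi (y 0 0)) x = if a == 0 then d else 0.
Proof.
move=> dphi; apply: is_derive_pd.
have H := is_derive_comp1 (is_derive_coord (0 : 'I_n.+1) x (delta_mx 0 a)) dphi.
apply: is_derive_eq H _; rewrite mxE eqxx eq_sym /=.
by case: eqP; rewrite ?mul1r ?mul0r.
Qed.

Lemma pd_gram a i j x : S x -> pd a (fun y => G y i j) x =
  if [&& a == 0, i == j & i != 0] then 2 * h (x 0 0) * w (x 0 0) else 0.
Proof.
move=> Sx; pose phi s := if i == j then (if i == 0 then 1 else w s) else 0 : R.
have E y : S y -> G y i j = phi (y 0 0).
  by move=> Sy; rewrite GE // warped_gramE.
rewrite (pd_eq_on _ S_open E Sx).
have dphi : is_derive (x 0 0) 1 phi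
    (if (i == j) && (i != 0) then 2 * h (x 0 0) * w (x 0 0) else 0).
  rewrite /phi; case: (i == j) => /=; last exact: is_derive_cst.
  case: (i == 0) => /=; first exact: is_derive_cst.
  exact: dw.
by rewrite (pd_fun0 _ dphi); case: (a == 0).
Qed.

Lemma christoffel_warped k i j x : S x -> christoffel G k i j x =
  warped_christoffel (- h (x 0 0) * w (x 0 0)) (h (x 0 0)) k i j.
Proof.
move=> Sx; rewrite /christoffel (bigD1 k) //= big1 ?addr0; last first.
  move=> m mk; rewrite GE // invmx_warped ?w_neq0 // warped_gramE eq_sym.
  by rewrite (negPf mk) mul0r.
rewrite GE // invmx_warped ?w_neq0 // warped_gramE eqxx !pd_gram //.
rewrite /warped_christoffel; have w0 := w_neq0 Sx.
have [kE|k0] := eqVneq k 0; have [iE|i0] := eqVneq i 0;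
  have [jE|j0] := eqVneq j 0; rewrite ?kE ?iE ?jE ?eqxx /= ?andbF /=;
  rewrite ?[0 == _]eq_sym ?(negPf k0) ?(negPf j0) ?(negPf i0) ?andbF ?andbT /=.
all: rewrite ?[k == _]eq_sym ?andbT; try by ring.
all: try (case: ifP => _ /=).
all: by [ring | field].
Qed.

Lemma pd_christoffel a k i j x : S x -> pd a (christoffel G k i j) x =
  if a == 0 then
    warped_christoffel (- (h' (x 0 0) + 2 * h (x 0 0) ^+ 2) * w (x 0 0))
      (h' (x 0 0)) k i j
  else 0.
Proof.
move=> Sx; rewrite (pd_eq_on _ S_open (@christoffel_warped k i j) Sx).
apply: (@pd_fun0 (fun s => warped_christoffel (- h s * w s) (h s) k i j)).
have dA : is_derive (x 0 0) 1 (fun s => - h s * w s)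
    (- (h' (x 0 0) + 2 * h (x 0 0) ^+ 2) * w (x 0 0)).
  have dhx := dh Sx; have dwx := dw Sx.
  have H : is_derive (x 0 0) 1 (fun s => - h s) (- h' (x 0 0)).
    exact: is_deriveN.
  apply: is_derive_eq (@is_deriveM _ _ _ _ _ _ _ _ H dwx) _.
  by rewrite /GRing.scale /=; ring.
rewrite /warped_christoffel.
by do !case: ifP => _; try exact: is_derive_cst; try exact: dh.
Qed.

Lemma mul_if_eq (k m : 'I_n) (b c : R) :
  (if m == k then b else 0) * (if k == m then c else 0) =
  (if m == k then b * c else 0).
Proof. by rewrite [k == m]eq_sym; case: eqP; rewrite ?mulr0. Qed.

Lemma mul_if_if (b : bool) (c d : R) :
  (if b then c else 0) * (if b then d else 0) = if b then c * d else 0.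
Proof. by case: b; rewrite ?mulr0. Qed.

(** With w = phi^2, so that h = phi' / phi, this is - n phi'' / phi. *)
Lemma ricci_warped0 x : S x ->
  ricci G 0 0 x = - n%:R * (h' (x 0 0) + h (x 0 0) ^+ 2).
Proof.
move=> Sx; rewrite /ricci.
under eq_bigr do rewrite !pd_christoffel //.
under [X in _ + X]eq_bigr do under eq_bigr do rewrite !christoffel_warped //.
rewrite !sum_ord0 !warped_christoffelE eqxx.
under eq_bigr do rewrite !warped_christoffelE eqxx /= sub0r.
under [X in _ + (_ + X + _)]eq_bigr do rewrite !warped_christoffelE mul0r subr0.
under [X in _ + (_ + X)]eq_bigr => k _.
  rewrite sum_ord0 !warped_christoffelE ?mulr0 ?mul0r subr0 add0r.
  under eq_bigr do rewrite !warped_christoffelE ?mul0r mul_if_eq sub0r.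
  rewrite sumrN sum_if_eq.
  over.
rewrite /= !sum_const_ord; ring.
Qed.

Lemma ricci_warpedS (i : 'I_n) x : S x ->
  ricci G (lift 0 i) (lift 0 i) x =
  - (h' (x 0 0) + n%:R * h (x 0 0) ^+ 2) * w (x 0 0).
Proof.
move=> Sx; rewrite /ricci.
under eq_bigr do rewrite !pd_christoffel //.
under [X in _ + X]eq_bigr do under eq_bigr do rewrite !christoffel_warped //.
rewrite !sum_ord0 !warped_christoffelE !eqxx.
under eq_bigr do rewrite /= subr0.
under [X in _ + (_ + X + _)]eq_bigr do
  rewrite !warped_christoffelE ?mul0r mul_if_if sub0r.
under [X in _ + (_ + X)]eq_bigr => k _.
  rewrite sum_ord0 !warped_christoffelE !eqxx mul_if_if.
  under eq_bigr do rewrite !warped_christoffelE ?mul0r subr0.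
  rewrite sum_const_ord mulr0 addr0.
  over.
rewrite /= sumrN sumrB !sum_const_ord !sum_if_eq; ring.
Qed.

(** With w'' / w = 2 h' + 4 h^2, this is the usual formula for the scalar
    curvature of a warped product with flat fibres. *)
Lemma scal_warped x : S x ->
  scal_coord G x = - (2 * n%:R * h' (x 0 0) + (n * n.+1)%:R * h (x 0 0) ^+ 2).
Proof.
move=> Sx; have w0 := w_neq0 Sx.
have E (i : 'I_n.+1) : \sum_j invmx (G x) i j * ricci G i j x =
    (if i == 0 then 1 else (w (x 0 0))^-1) * ricci G i i x.
  rewrite GE // invmx_warped //.
  rewrite (bigD1 i) //= big1 ?addr0 => [|j ji].
    by rewrite warped_gramE eqxx.
  by rewrite warped_gramE eq_sym (negPf ji) mul0r.
rewrite /scal_coord; under eq_bigr do rewrite E.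
rewrite sum_ord0 eqxx ricci_warped0 //.
under eq_bigr do rewrite ricci_warpedS //=.
by rewrite sum_const_ord natrM -natr1; field.
Qed.

Lemma inward_normal_warped x : S x -> inward_normal G x = delta_mx 0 0.
Proof.
move=> Sx; rewrite /inward_normal.
have -> : \row_j ((val j == 0)%N)%:R = delta_mx 0 0 :> 'rV[R]_n.+1.
  by apply/rowP => j; rewrite !mxE.
have E : delta_mx 0 0 *m invmx (G x) = delta_mx 0 0 :> 'rV[R]_n.+1.
  rewrite GE // invmx_warped ?w_neq0 // -rowE; apply/rowP => j.
  by rewrite [LHS]mxE warped_gramE mxE eqxx [0 == j]eq_sym; case: eqP.
rewrite E trmx_delta mul_delta_mx mxE !eqxx /=.
by rewrite sqrtr1 invr1 scale1r.
Qed.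

(** The unit normal is the coordinate field d_0, whose covariant derivative along
    d_a has component Gamma^a_a0 = h on d_a. *)
Lemma mean_curvature_warped x : (0 < n)%N -> S x ->
  mean_curvature_coord G x = - h (x 0 0).
Proof.
move=> n0 Sx; rewrite /mean_curvature_coord /=.
have E a : a != 0 -> nabla_normal G a a x = h (x 0 0).
  move=> a0; rewrite /nabla_normal.
  have Ec y : S y -> inward_normal G y 0 a = cst 0 y.
    by move=> Sy; rewrite inward_normal_warped // mxE (negPf a0) andbF.
  rewrite (pd_eq_on _ S_open Ec Sx) (is_derive_pd (is_derive_cst _ _ _)) add0r.
  rewrite (bigD1 0) //= big1 => [|m m0].
    rewrite inward_normal_warped // mxE !eqxx mulr1 addr0 christoffel_warped //.
    by rewrite /warped_christoffel (negPf a0) eqxx.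
  by rewrite inward_normal_warped // mxE (negPf m0) andbF mulr0.
rewrite big_mkcond sum_ord0 /= add0r.
under eq_bigr do rewrite E //.
rewrite sum_const_ord; field.
by rewrite pnatr_eq0 -lt0n.
Qed.

End WarpedProduct.

(** * The angle of a point of the unit circle *)

Section Angle.
Context {R : realType}.

(** The angle in ]-pi, pi[ of the point (c, s) of the unit circle, obtained from
    the half angle formula tan (x / 2) = sin x / (1 + cos x). *)
Definition angle (c s : R) : R := 2 * atan (s / (1 + c)).

Lemma cos_gtN1 (x : R) : - pi < x < pi -> -1 < cos x.
Proof.
move=> /andP[x1 x2].
have c0 : 0 < cos (x / 2) by apply: cos_gt0_pihalf; apply/andP; split; lra.
have -> : cos x = cos (x / 2) ^+ 2 *+ 2 - 1.
  by rewrite -cos_mulr2n; congr cos; lra.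
by rewrite ltrBrDr addNr pmulrn_lgt0 // exprn_gt0.
Qed.

Lemma angle_cos_sin (x : R) : - pi < x < pi -> angle (cos x) (sin x) = x.
Proof.
move=> /andP[x1 x2].
have xh : - (pi / 2) < x / 2 < pi / 2 by apply/andP; split; lra.
have c0 : 0 < cos (x / 2) by exact: cos_gt0_pihalf.
rewrite /angle (_ : sin x / (1 + cos x) = tan (x / 2)); last first.
  have xE : x = (x / 2) *+ 2 by rewrite mulr2n; lra.
  rewrite {1 2}xE sin_mulr2n cos_mulr2n /tan.
  have c1 : cos (x / 2) != 0 by rewrite gt_eqF.
  move: (cos _) (sin _) c1 => c s c1; field.
  by rewrite c1 /= (_ : 1 + _ = c ^+ 2 *+ 2) ?mulrn_eq0 ?expf_neq0 //; ring.
by rewrite tanK ?in_itv //=; lra.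
Qed.

Lemma unit_circle_angle (c s : R) : c ^+ 2 + s ^+ 2 = 1 ->
  exists x, [/\ - pi <= x <= pi, cos x = c & sin x = s].
Proof.
move=> E; have c1 : -1 <= c <= 1.
  rewrite -ler_norml -(@expr_le1 _ 2) // real_normK ?num_real // -E lerDl.
  exact: sqr_ge0.
have p0 := pi_ge0 R.
have a0 := acos_ge0 c1; have ap := acos_lepi c1.
have sE : Num.sqrt (1 - c ^+ 2) = `|s|.
  by rewrite -E addrAC subrr add0r sqrtr_sqr.
have [s0|s0] := leP 0 s.
  exists (acos c); split; rewrite ?acosK ?in_itv //.
    by apply/andP; split; lra.
  by rewrite sin_acos // sE ger0_norm.
exists (- acos c); split; rewrite ?cosN ?acosK ?in_itv //.
  by apply/andP; split; lra.
by rewrite sinN sin_acos // sE ltr0_norm // opprK.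
Qed.

Lemma unit_circle_angle_open (c s : R) : c ^+ 2 + s ^+ 2 = 1 -> -1 < c ->
  exists x, [/\ - pi < x < pi, cos x = c & sin x = s].
Proof.
move=> E c1; have [x [/andP[x1 x2] cx sx]] := unit_circle_angle E.
exists x; split=> //; rewrite !lt_neqAle x1 x2 !andbT.
apply/andP; split; apply/eqP => xE; move: c1; rewrite -cx.
  by rewrite -xE cosN cospi ltxx.
by rewrite xE cospi ltxx.
Qed.

Lemma continuous_angle (T : topologicalType) (c s : T -> R) (p : T) :
  {for p, continuous c} -> {for p, continuous s} -> -1 < c p ->
  {for p, continuous (fun q => angle (c q) (s q))}.
Proof.
move=> cc cs c1; apply: cvgM; first exact: cvg_cst.
apply: (@continuous_comp _ _ _ (fun q => s q / (1 + c q)) atan); last first.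
  exact: continuous_atan.
apply: cvgM => //; apply: cvgV; first by rewrite gt_eqF //; lra.
by apply: cvgD => //; exact: cvg_cst.
Qed.

End Angle.

(** * The band: torus times interval *)

Section Band.
Context {R : realType} {m : nat}.
Variable l : R.
Hypothesis l_gt0 : 0 < l.
Implicit Types (t x y v : 'rV[R]_m.+2) (a b : 'I_m.+2).

Let l_ge0 : 0 <= l. Proof. exact: ltW. Qed.

(** Retracts the line onto the interval, so that the parametrization of the band
    by angles and the inverses of its charts are defined everywhere. *)
Definition clamp (r : R) : R := Num.max (- l) (Num.min l r).

Definition band_embedding t : 'M[R]_(2, m.+2) :=
  \matrix_(i, a) if a == 0 then (if i == 0 then clamp (t 0 0) else 0)
                 else (if i == 0 then cos (t 0 a) else sin (t 0 a)).

(** The product of an interval with a torus, as a subspace of a space of matrices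
    whose column 0 holds the real coordinate and whose column a, for a <> 0, is
    a point of the unit circle.  Hence the topology is Hausdorff, and the
    functions to and from the band that occur are visibly continuous. *)
Definition band : Type := set_type (range band_embedding).
HB.instance Definition _ := Topological.on band.

Definition band_proj t : band :=
  exist _ (band_embedding t) (mem_set (imageT band_embedding t)).

Definition height (p : band) : R := set_val p 0 0.
Definition circle_cos a (p : band) : R := set_val p 0 a.
Definition circle_sin a (p : band) : R := set_val p 1 a.

Lemma clampE (r : R) : `|r| <= l -> clamp r = r.
Proof.
rewrite ler_norml => /andP[rl lr].
by rewrite /clamp min_r ?max_r.
Qed.

Lemma clamp_le (r : R) : `|clamp r| <= l.
Proof.
rewrite ler_norml /clamp le_max lexx /= ge_max ge_min lexx /= andbT.
by have := l_ge0; lra.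
Qed.

Lemma height_proj t : height (band_proj t) = clamp (t 0 0).
Proof. by rewrite /height set_valE /= mxE. Qed.

Lemma circle_cos_proj a t : a != 0 -> circle_cos a (band_proj t) = cos (t 0 a).
Proof. by move=> a0; rewrite /circle_cos set_valE /= mxE (negPf a0). Qed.

Lemma circle_sin_proj a t : a != 0 -> circle_sin a (band_proj t) = sin (t 0 a).
Proof. by move=> a0; rewrite /circle_sin set_valE /= mxE (negPf a0). Qed.

Lemma eq_band_proj t t' : clamp (t 0 0) = clamp (t' 0 0) ->
  (forall a, a != 0 -> cos (t 0 a) = cos (t' 0 a) /\ sin (t 0 a) = sin (t' 0 a)) ->
  band_proj t = band_proj t'.
Proof.
move=> h0 ha; apply: val_inj => /=; apply/matrixP => i a; rewrite !mxE h0.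
by case: eqVneq => // a0; have [-> ->] := ha a a0.
Qed.

(** Bounding the angles makes the band the image of a compact box. *)
Lemma band_projP (p : band) : exists t, [/\ `|t 0 0| <= l,
  (forall a, a != 0 -> `|t 0 a| <= pi) & p = band_proj t].
Proof.
case: p => q qE; have [t _ tq] := set_mem qE.
have H (a : 'I_m.+2) : exists r : R,
    [/\ - pi <= r <= pi, cos r = cos (t 0 a) & sin r = sin (t 0 a)].
  by apply: unit_circle_angle; rewrite cos2Dsin2.
have [r Hr] := choice H.
exists (\row_a if a == 0 then clamp (t 0 0) else r a); split.
- by rewrite mxE eqxx clamp_le.
- by move=> a a0; rewrite mxE (negPf a0) ler_norml; have [] := Hr a.
- have -> : exist _ q qE = band_proj t :> band by apply: val_inj.
  apply: eq_band_proj => [|a a0]; rewrite mxE ?eqxx.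
    by rewrite [in RHS]clampE ?clamp_le.
  by rewrite (negPf a0); have [_ -> ->] := Hr a.
Qed.

Lemma height_le p : `|height p| <= l.
Proof. by have [t [_ _ ->]] := band_projP p; rewrite height_proj clamp_le. Qed.

Lemma circle_cos_sin a p : a != 0 -> circle_cos a p ^+ 2 + circle_sin a p ^+ 2 = 1.
Proof.
move=> a0; have [t [_ _ ->]] := band_projP p.
by rewrite circle_cos_proj // circle_sin_proj // cos2Dsin2.
Qed.

Lemma continuous_clamp : continuous clamp.
Proof.
move=> r; apply: (@continuous_max _ _ (cst (- l)) (cst l \min id)).
  exact: cvg_cst.
by apply: (@continuous_min _ _ (cst l) id); [exact: cvg_cst|exact: cvg_id].
Qed.

Lemma continuous_band_proj : continuous band_proj.
Proof.
have ce : continuous band_embedding.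
  move=> t; apply: (@cvg_mx _ (nbhs t) (nbhs_filter t)) => i a.
  have cc b : (fun x : 'rV[R]_m.+2 => x 0 b) @ t --> t 0 b := @coord_continuous R 1 m.+2 0 b t.
  under eq_fun do rewrite mxE.
  rewrite mxE; case: (a == 0); case: (i == 0).
  - exact: (continuous_comp (cc 0) (@continuous_clamp _)).
  - exact: cvg_cst.
  - exact: (continuous_comp (cc a) (@continuous_cos _ _)).
  - exact: (continuous_comp (cc a) (@continuous_sin _ _)).
apply/continuousP => _ [A oA <-].
by move/continuousP: ce => /(_ A oA).
Qed.

Lemma continuous_set_val_band : continuous (set_val : band -> 'M[R]_(2, m.+2)).
Proof. exact: initial_continuous. Qed.

Lemma continuous_height : continuous height.
Proof.
move=> p; apply: (@continuous_comp _ _ _ set_val (fun M : 'M[R]_(2, m.+2) => M 0 0)).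
  exact: continuous_set_val_band.
exact: coord_continuous.
Qed.

Lemma continuous_norm_height : continuous (fun p => `|height p|).
Proof.
move=> p; apply: (@continuous_comp _ _ _ height Num.norm).
  exact: continuous_height.
exact: norm_continuous.
Qed.

Lemma continuous_circle_cos a : continuous (circle_cos a).
Proof.
move=> p; apply: (@continuous_comp _ _ _ set_val (fun M : 'M[R]_(2, m.+2) => M 0 a)).
  exact: continuous_set_val_band.
exact: coord_continuous.
Qed.

Lemma continuous_circle_sin a : continuous (circle_sin a).
Proof.
move=> p; apply: (@continuous_comp _ _ _ set_val (fun M : 'M[R]_(2, m.+2) => M 1 a)).
  exact: continuous_set_val_band.
exact: coord_continuous.
Qed.

Lemma band_hausdorff : hausdorff_space band.
Proof.
move=> p q pq; apply: val_inj.
apply: (@norm_hausdorff R 'M[R]_(2, m.+2)) => A B Ap Bq.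
have [r [Ar Br]] := pq _ _ (continuous_set_val_band Ap) (continuous_set_val_band Bq).
by exists (set_val r).
Qed.

Lemma band_compact : compact [set: band].
Proof.
pose K := [set t : 'rV[R]_m.+2 | forall a,
  (if a == 0 then `[- l, l]%classic else `[- pi, pi]%classic : set R) (t 0 a)].
have cK : compact K.
  apply: (@rV_compact R m.+2
    (fun a => if a == 0 then `[- l, l]%classic else `[- pi, pi]%classic)) => a.
  by case: ifP => _; exact: segment_compact.
have <- : band_proj @` K = [set: band].
  apply/seteqP; split=> // p _; have [t [t0 ta pE]] := band_projP p.
  exists t => // a; case: eqVneq => [->|a0] /=; rewrite in_itv /= -ler_norml //.
  exact: ta.
apply: continuous_compact => //.
by apply: continuous_subspaceT; exact: continuous_band_proj.
Qed.

Lemma band_connected : connected [set: band].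
Proof.
have -> : [set: band] = \bigcup_(t in [set: 'rV[R]_m.+2])
    (band_proj \o (fun r : R => r *: t)) @` `[0, 1]%classic.
  apply/seteqP; split=> // p _; have [t [_ _ pE]] := band_projP p.
  exists t => //; exists 1; rewrite ?pE /= ?scale1r //.
  by rewrite in_itv /= ler01 lexx.
apply: bigcup_connected.
  exists (band_proj 0) => t _; exists 0; rewrite /= ?scale0r //.
  by rewrite in_itv /= ler01 lexx.
move=> t _; apply: connected_continuous_connected; first exact: segment_connected.
apply: continuous_subspaceT => r; apply: continuous_comp.
  exact: (@scalel_continuous R 'rV[R]_m.+2).
exact: continuous_band_proj.
Qed.

End Band.

(** * Charts of the band *)

Section Charts.
Context {R : realType} {m : nat}.
Variable l : R.
Hypothesis l_gt0 : 0 < l.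
Local Notation band := (@band R m l).
Local Notation proj := (@band_proj R m l).
Local Notation atlas := (bool * ('I_m.+2 -> bool))%type.
Implicit Types (i j : atlas) (p : band) (x y : 'rV[R]_m.+2) (a b : 'I_m.+2).

(** A chart is given by the end of the interval from which the first coordinate
    is measured and, for each circle, by the one of the two points of angle 0
    and pi on which it is centred.  Measuring from the other end reverses both
    the coordinate 0 and the coordinate 1, which keeps the orientation. *)
Definition axis_sign i a : R := if (a <= 1)%N then (-1) ^+ i.1 else 1.
Definition circle_sign i a : R := (-1) ^+ (i.2 a).

Definition band_lift i x : 'rV[R]_m.+2 :=
  \row_a if a == 0 then axis_sign i 0 * (x 0 0 - l)
         else axis_sign i a * x 0 a + (i.2 a)%:R * pi.

Definition band_chart_inv i x : band := proj (band_lift i x).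

Definition band_chart i p : 'rV[R]_m.+2 :=
  \row_a if a == 0 then l + axis_sign i 0 * height p
         else axis_sign i a * angle (circle_sign i a * circle_cos a p)
                                    (circle_sign i a * circle_sin a p).

Definition band_dom i : set band :=
  [set p | axis_sign i 0 * height p < l /\
    forall a, a != 0 -> -1 < circle_sign i a * circle_cos a p].

Definition chart_box : set 'rV[R]_m.+2 :=
  [set x | x 0 0 < 2 * l /\ forall a, a != 0 -> `|x 0 a| < pi].

Definition chart_range : set 'rV[R]_m.+2 := @half_space R m.+2 `&` chart_box.

Lemma half_spaceE x : @half_space R m.+2 x <-> 0 <= x 0 0.
Proof.
split=> [|x0 a a0]; first by apply.
by rewrite (_ : a = 0) //; exact: val_inj.
Qed.

Lemma axis_sign_sq i a : axis_sign i a * axis_sign i a = 1.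
Proof.
rewrite /axis_sign; case: ifP => _; last by rewrite mulr1.
by rewrite -expr2 sqrr_sign.
Qed.

Lemma norm_axis_sign i a : `|axis_sign i a| = 1.
Proof.
by rewrite /axis_sign; case: ifP => _; rewrite ?normr1 // normr_sign.
Qed.

Lemma circle_sign_sq i a : circle_sign i a * circle_sign i a = 1.
Proof. by rewrite -expr2 sqrr_sign. Qed.

Lemma cos_circle_sign i a (r : R) :
  cos (r + (i.2 a)%:R * pi) = circle_sign i a * cos r.
Proof.
rewrite /circle_sign; case: (i.2 a); rewrite ?mul1r ?mul0r ?addr0 ?expr0 ?mul1r //.
by rewrite cosDpi expr1 mulN1r.
Qed.

Lemma sin_circle_sign i a (r : R) :
  sin (r + (i.2 a)%:R * pi) = circle_sign i a * sin r.
Proof.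
rewrite /circle_sign; case: (i.2 a); rewrite ?mul1r ?mul0r ?addr0 ?expr0 ?mul1r //.
by rewrite sinDpi expr1 mulN1r.
Qed.

Lemma band_lift0_le i x : chart_range x -> `|band_lift i x 0 0| <= l.
Proof.
move=> [/half_spaceE x0 [x1 _]].
by rewrite mxE eqxx normrM norm_axis_sign mul1r ler_norml; lra.
Qed.

Lemma height_chart_inv i x : chart_range x ->
  height (band_chart_inv i x) = axis_sign i 0 * (x 0 0 - l).
Proof.
move=> Sx; rewrite height_proj clampE ?band_lift0_le // mxE eqxx //.
Qed.

Lemma angle_axis_sign i a (r : R) : `|r| < pi ->
  axis_sign i a * angle (cos (axis_sign i a * r)) (sin (axis_sign i a * r)) = r.
Proof.
move=> rpi; rewrite angle_cos_sin; last first.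
  by rewrite -ltr_norml normrM norm_axis_sign mul1r.
by rewrite mulrA axis_sign_sq mul1r.
Qed.

(** Together with the next lemma: the parametrization is a bijection from the
    range common to all charts onto the domain of the chart. *)
Lemma band_chart_invK i x : chart_range x ->
  band_dom i (band_chart_inv i x) /\ band_chart i (band_chart_inv i x) = x.
Proof.
move=> Sx; have [/half_spaceE x0 [x1 xa]] := Sx.
have Hc a : a != 0 -> circle_sign i a * circle_cos a (band_chart_inv i x) =
    cos (axis_sign i a * x 0 a).
  move=> a0; rewrite circle_cos_proj // mxE (negPf a0) cos_circle_sign.
  by rewrite mulrA circle_sign_sq mul1r.
have Hs a : a != 0 -> circle_sign i a * circle_sin a (band_chart_inv i x) =
    sin (axis_sign i a * x 0 a).
  move=> a0; rewrite circle_sin_proj // mxE (negPf a0) sin_circle_sign.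
  by rewrite mulrA circle_sign_sq mul1r.
split; [split=> [|a a0]|].
- by rewrite height_chart_inv // mulrA axis_sign_sq mul1r; lra.
- rewrite Hc //; apply: cos_gtN1; rewrite -ltr_norml normrM norm_axis_sign mul1r.
  exact: xa.
- apply/rowP => a; rewrite mxE; case: eqVneq => [->|a0].
    by rewrite height_chart_inv // mulrA axis_sign_sq; lra.
  by rewrite Hc // Hs // angle_axis_sign // xa.
Qed.

Lemma band_chart_inv_onto i p : band_dom i p ->
  exists2 x, chart_range x & p = band_chart_inv i x.
Proof.
move=> [pl pa]; have hp := height_le l_gt0 p.
have H a : exists r : R, a != 0 -> [/\ `|r| < pi,
    cos r = circle_sign i a * circle_cos a p &
    sin r = circle_sign i a * circle_sin a p].
  have [->|a0] := eqVneq a 0; first by exists 0.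
  have E : (circle_sign i a * circle_cos a p) ^+ 2 +
           (circle_sign i a * circle_sin a p) ^+ 2 = 1.
    by rewrite !exprMn -mulrDr circle_cos_sin // expr2 circle_sign_sq mulr1.
  have [r [r1 r2 r3]] := unit_circle_angle_open E (pa a a0).
  by exists r => _; split=> //; rewrite ltr_norml.
have [r Hr] := choice H.
pose x : 'rV[R]_m.+2 := \row_a if a == 0 then l + axis_sign i 0 * height p
                               else axis_sign i a * r a.
have hs : `|axis_sign i 0 * height p| <= l.
  by rewrite normrM norm_axis_sign mul1r.
have Sx : chart_range x.
  split; first by apply/half_spaceE; rewrite mxE eqxx; move: hs; rewrite ler_norml; lra.
  split=> [|a a0]; first by rewrite mxE eqxx; lra.
  by rewrite mxE (negPf a0) normrM norm_axis_sign mul1r; have [] := Hr a a0.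
exists x => //; have [t [t0 _ tE]] := band_projP l_gt0 p.
rewrite tE; apply: eq_band_proj => [|a a0].
  rewrite !clampE ?band_lift0_le // mxE eqxx mxE eqxx.
  by rewrite addrAC subrr add0r mulrA axis_sign_sq mul1r tE height_proj clampE.
rewrite mxE (negPf a0) cos_circle_sign sin_circle_sign mxE (negPf a0).
rewrite mulrA axis_sign_sq mul1r; have [_ -> ->] := Hr a a0.
by rewrite !mulrA circle_sign_sq !mul1r tE circle_cos_proj // circle_sin_proj.
Qed.

Lemma band_chart_in i p : band_dom i p -> chart_range (band_chart i p).
Proof.
move=> /band_chart_inv_onto[x Sx ->].
by have [_ ->] := band_chart_invK i Sx.
Qed.

Lemma band_chartK i p : band_dom i p -> band_chart_inv i (band_chart i p) = p.
Proof.
move=> /band_chart_inv_onto[x Sx ->].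
by have [_ ->] := band_chart_invK i Sx.
Qed.

Lemma band_chart_image i : band_chart i @` band_dom i = chart_range.
Proof.
apply/seteqP; split=> [_ [p ip <-]|x Sx]; first exact: band_chart_in.
by have [dx xE] := band_chart_invK i Sx; exists (band_chart_inv i x).
Qed.

Lemma open_coord_lt b (r : R) : open [set x : 'rV[R]_m.+2 | x 0 b < r].
Proof.
apply: (@open_comp _ _ (fun x : 'rV[R]_m.+2 => x 0 b) [set s | s < r]); last exact: open_lt.
by move=> x _; exact: coord_continuous.
Qed.

Lemma open_coord_norm_lt b (r : R) : open [set x : 'rV[R]_m.+2 | `|x 0 b| < r].
Proof.
apply: (@open_comp _ _ (fun x : 'rV[R]_m.+2 => `|x 0 b|) [set s | s < r]); last exact: open_lt.
move=> x _; apply: (@continuous_comp _ _ _ (fun x : 'rV[R]_m.+2 => x 0 b) Num.norm).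
  exact: coord_continuous.
exact: norm_continuous.
Qed.

Lemma open_forall_neq0 (T : topologicalType) (P : 'I_m.+2 -> set T) :
  (forall a, open (P a)) -> open [set p | forall a, a != 0 -> P a p].
Proof.
move=> oP; rewrite openE => p Pp; rewrite /interior /=.
apply: filter_forall => a; have [->|a0] := eqVneq a 0; first exact: nearW.
have : \forall q \near p, P a q by apply: open_nbhs_nbhs; split=> //; exact: Pp.
by apply: filterS.
Qed.

Lemma open_chart_box : open chart_box.
Proof.
apply: openI; first exact: open_coord_lt.
by apply: open_forall_neq0 => a; exact: open_coord_norm_lt.
Qed.

Lemma band_dom_open i : open (band_dom i).
Proof.
apply: openI.
  apply: (@open_comp _ _ (fun p => axis_sign i 0 * height p) [set s | s < l]).
    move=> p _; apply: continuous_mulc; exact: continuous_height.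
  exact: open_lt.
apply: (@open_forall_neq0 _
  (fun a => [set p : band | -1 < circle_sign i a * circle_cos a p])) => a.
apply: (@open_comp _ _ (fun p => circle_sign i a * circle_cos a p)
  [set s | -1 < s]); last exact: open_gt.
by move=> p _; apply: continuous_mulc; exact: continuous_circle_cos.
Qed.

Lemma band_chart_continuous i p : band_dom i p -> {for p, continuous (band_chart i)}.
Proof.
move=> [_ pa]; apply: (@cvg_mx _ (nbhs p) (nbhs_filter p)) => z a.
under eq_fun do rewrite mxE; rewrite mxE; case: eqVneq => [_|a0].
  apply: cvgD; first exact: cvg_cst.
  by apply: continuous_mulc; exact: continuous_height.
apply: (@continuous_mulc _ _ _ (fun q => angle
  (circle_sign i a * circle_cos a q) (circle_sign i a * circle_sin a q)) p).
apply: (@continuous_angle R band (fun q => circle_sign i a * circle_cos a q)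
  (fun q => circle_sign i a * circle_sin a q)).
- by apply: continuous_mulc; exact: continuous_circle_cos.
- by apply: continuous_mulc; exact: continuous_circle_sin.
- exact: pa.
Qed.

Lemma continuous_band_lift i : continuous (band_lift i).
Proof.
move=> x; apply: (@cvg_mx _ (nbhs x) (nbhs_filter x)) => z a.
have cc b : (fun x : 'rV[R]_m.+2 => x 0 b) @ x --> x 0 b := @coord_continuous R 1 m.+2 0 b x.
under eq_fun do rewrite mxE; rewrite mxE; case: eqVneq => [_|a0].
  apply: (@continuous_mulc _ _ _ (fun x : 'rV[R]_m.+2 => x 0 0 - l) x).
  rewrite /prop_for /continuous_at.
  exact: (cvgB (cc 0) (cvg_cst l)).
apply: cvgD; last exact: cvg_cst.
by apply: (@continuous_mulc _ _ _ (fun x : 'rV[R]_m.+2 => x 0 a) x); exact: cc.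
Qed.

Lemma band_chart_inv_continuous i : continuous (band_chart_inv i).
Proof.
move=> x; apply: continuous_comp; first exact: continuous_band_lift.
exact: continuous_band_proj.
Qed.

(** Measuring from the closer end, and the angle on each circle from the closer
    of the points of angle 0 and pi, keeps p in the domain of the chart. *)
Definition band_chart_at p : atlas :=
  (0 < height p, fun a => circle_cos a p < 0).

Lemma band_dom_chart_at p : band_dom (band_chart_at p) p.
Proof.
split=> [|a a0]; rewrite /axis_sign /circle_sign /=.
  have [h0|h0] := ltrP 0 (height p); rewrite ?expr1 ?expr0;
    by have := l_gt0; lra.
by have [h0|h0] := ltrP (circle_cos a p) 0; rewrite ?expr1 ?expr0; lra.
Qed.

End Charts.

(** * The band as a manifold *)

Section BandManifold.
Context {R : realType} {m : nat}.
Variable l : R.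
Hypothesis l_gt0 : 0 < l.
Local Notation band := (@band R m l).
Local Notation proj := (@band_proj R m l).
Local Notation atlas := (bool * ('I_m.+2 -> bool))%type.
Local Notation dom := (@band_dom R m l).
Local Notation chart := (@band_chart R m l).
Local Notation chart_inv := (@band_chart_inv R m l).
Local Notation range := (@chart_range R m l).
Implicit Types (i j : atlas) (p : band) (x y : 'rV[R]_m.+2) (a b : 'I_m.+2).

Lemma band_lift_shift i x y a :
  band_lift l i y 0 a = band_lift l i x 0 a + axis_sign i a * (y 0 a - x 0 a).
Proof. by rewrite !mxE; case: eqVneq => [->|_]; ring. Qed.

(** The affine map which a change of charts is near the point p. *)
Definition transition_map i j p x : 'rV[R]_m.+2 :=
  \row_a (chart j p 0 a + axis_sign i a * axis_sign j a * (x 0 a - chart i p 0 a)).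

(** In the angles and the distance to an end, changes of charts are locally
    translations composed with reflections of axes. *)
Lemma band_transition_near i j p : dom i p -> dom j p ->
  \forall x \near chart i p, @half_space R m.+2 x ->
    chart j (chart_inv i x) = transition_map i j p x.
Proof.
move=> ip jp; set x0 := chart i p; set y0 := chart j p.
have Sx0 : range x0 by exact: band_chart_in.
have Sy0 : range y0 by exact: band_chart_in.
have cT : {for x0, continuous (transition_map i j p)}.
  apply: (@cvg_mx _ (nbhs x0) (nbhs_filter x0)) => z a.
  have cc : (fun x : 'rV[R]_m.+2 => x 0 a) @ x0 --> x0 0 a :=
    @coord_continuous R 1 m.+2 0 a x0.
  under eq_fun do rewrite mxE; rewrite mxE; apply: cvgD; first exact: cvg_cst.
  apply: (@continuous_mulc _ _ _ (fun x : 'rV[R]_m.+2 => x 0 a - chart i p 0 a) x0).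
  exact: (cvgB cc (cvg_cst _)).
have T0 : transition_map i j p x0 = y0.
  by apply/rowP => a; rewrite mxE subrr mulr0 addr0.
near=> x => Hx.
have bx : chart_box l x.
  near: x; apply: open_nbhs_nbhs; split; [exact: open_chart_box|exact: Sx0.2].
have bTx : chart_box l (transition_map i j p x).
  near: x; apply: (cT (chart_box l)); rewrite T0.
  apply: open_nbhs_nbhs; split; [exact: open_chart_box|exact: Sy0.2].
set y := transition_map i j p x in bTx *.
have Sx : range x by [].
have Ly a : band_lift l j y 0 a = band_lift l j y0 0 a + axis_sign i a * (x 0 a - x0 0 a).
  rewrite (band_lift_shift j y0 y) [y 0 a]mxE addrAC subrr add0r; congr (_ + _).
  by rewrite mulrA mulrCA axis_sign_sq mulr1.
have Lx a : band_lift l i x 0 a = band_lift l i x0 0 a + axis_sign i a * (x 0 a - x0 0 a).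
  exact: band_lift_shift.
have pE : chart_inv i x0 = chart_inv j y0 by rewrite !band_chartK.
(* The two charts may measure from different ends; y is in the half space
   because both give the same height, which is in the interval. *)
have L0 : band_lift l j y 0 0 = band_lift l i x 0 0.
  rewrite Lx Ly; congr (_ + _).
  have := congr1 (@height R m l) pE.
  by rewrite !height_proj !clampE ?band_lift0_le.
have Sy : range y.
  split=> //; apply/half_spaceE; have := band_lift0_le i Sx.
  rewrite -L0 mxE eqxx normrM norm_axis_sign mul1r ler_norml; lra.
have -> : chart_inv i x = chart_inv j y; last by have [] := band_chart_invK j Sy.
apply: eq_band_proj => [|a a0]; first by rewrite L0.
have Ec : cos (band_lift l i x0 0 a) = cos (band_lift l j y0 0 a).
  by have := congr1 (circle_cos a) pE; rewrite !circle_cos_proj.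
have Es : sin (band_lift l i x0 0 a) = sin (band_lift l j y0 0 a).
  by have := congr1 (circle_sin a) pE; rewrite !circle_sin_proj.
by rewrite Lx Ly !cosD !sinD Ec Es.
Unshelve. all: by end_near. Qed.

Lemma band_transition_smooth i j b :
  smooth_on (chart i @` (dom i `&` dom j)) (fun x => chart j (chart_inv i x) 0 b).
Proof.
move=> _ [p [ip jp] <-].
have := band_transition_near ip jp.
rewrite /prop_near1 nbhsE => -[U [oU Ux] UT].
exists U, (fun x => transition_map i j p x 0 b); split=> //.
  move=> k; apply: (@Ck_sub _ _ _ [set: 'rV[R]_m.+2]) => //.
  have C c : Ck k [set: 'rV[R]_m.+2] (cst c) := Ck_cst k _ c.
  have H := Ck_sub_fun openT (Ck_coord R b k) (C (chart i p 0 b)).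
  have := Ck_add openT (C (chart j p 0 b))
    (Ck_mul openT (C (axis_sign i b * axis_sign j b)) H).
  by apply: (Ck_ext openT) => x _; rewrite [RHS]mxE.
move=> _ [q [qi qj] <-] Uq; rewrite UT //.
by have [] := band_chart_in l_gt0 qi.
Qed.

Lemma band_chart_image_half_space i : exists2 V : set 'rV[R]_m.+2,
  open V & chart i @` dom i = @half_space R m.+2 `&` V.
Proof.
by exists (chart_box l); [exact: open_chart_box|rewrite band_chart_image].
Qed.

Definition band_manifold : cmanifold R m.+2 :=
  @CManifold R m.+2 band atlas dom chart chart_inv (@band_chart_at R m l)
    (band_dom_chart_at l_gt0) (@band_dom_open R m l) band_chart_image_half_space
    (band_chartK l_gt0) (@band_chart_continuous R m l)
    (fun i => continuous_subspaceT (@band_chart_inv_continuous R m l i))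
    band_transition_smooth (@band_hausdorff R m l) (@band_compact R m l l_gt0).

Local Notation M := band_manifold.

Lemma band_transition i j p : dom i p -> dom j p ->
  @transition R m.+2 M i j p = diag_mx (\row_a (axis_sign i a * axis_sign j a)).
Proof.
move=> ip jp; apply/matrixP => a b; rewrite !mxE.
transitivity (pd a (fun x => transition_map i j p x 0 b) (chart i p)).
  apply: pd_ext.
    have Hx : @half_space R m.+2 (chart i p) by have [] := band_chart_in l_gt0 ip.
    have Hh := right_open_half_space (@openT 'rV[R]_m.+2) a (conj Hx I).
    near=> h; apply: (congr1 (fun z : 'rV[R]_m.+2 => z 0 b)).
    suff : @half_space R m.+2 (chart i p + h *: delta_mx 0 a).
      by near: h; exact: (near_right_shift a (band_transition_near ip jp)).
    by near: h; apply: filterS Hh => h [].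
  rewrite [RHS]mxE subrr mulr0 addr0.
  by apply: (congr1 (fun q => chart j q 0 b)); exact: band_chartK.
apply: is_derive_pd; apply: is_derive_affine1 => h.
rewrite /transition_map; move: (chart i p) (chart j p) => u v.
rewrite !mxE /= [b == a]eq_sym; case: eqP => [->|_]; rewrite ?mulr1n ?mulr0n; ring.
Unshelve. all: by end_near. Qed.

(** The axes 0 and 1 are reflected together. *)
Lemma prod_axis_sign i j :
  \prod_a (axis_sign i a * axis_sign j a : R) = 1.
Proof.
rewrite !big_ord_recl big1 => [|a _]; last by rewrite /axis_sign /= mulr1.
by rewrite mulr1 /axis_sign /=; case: i.1; case: j.1;
  rewrite ?expr0 ?expr1; ring.
Qed.

Lemma band_oriented : oriented M.
Proof.
move=> i j p ip jp; rewrite band_transition // det_diag.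
by under eq_bigr do rewrite mxE; rewrite prod_axis_sign.
Qed.

(** The parametrization of the band is affine in each chart, so that smoothness
    may be checked on functions of the height and the angles. *)
Lemma smooth_on_band (q : band -> R) (Q : 'rV[R]_m.+2 -> R) (O : set 'rV[R]_m.+2) i :
  open O -> (forall t : 'rV[R]_m.+2, `|t 0 0| <= l -> O t) -> (forall k, Ck k O Q) ->
  (forall t : 'rV[R]_m.+2, `|t 0 0| <= l -> q (proj t) = Q t) ->
  smooth_on (chart i @` dom i) (fun x => q (chart_inv i x)).
Proof.
move=> oO lO CQ qQ x; rewrite band_chart_image // => Sx.
exists (band_lift l i @^-1` O), (Q \o band_lift l i); split.
- apply: open_comp => // y _; exact: continuous_band_lift.
- by apply: lO; exact: band_lift0_le.
- move=> k; apply: (@Ck_affine R 'rV[R]_m.+2 'rV[R]_m.+2 k (band_lift l i)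
    (fun v => \row_a (axis_sign i a * v 0 a)) Q O) => //.
    exact: continuous_band_lift.
  move=> y v h; apply/rowP => a; rewrite !mxE.
  by case: eqVneq => [->|_]; ring.
- by move=> y Sy _; apply: qQ; exact: band_lift0_le.
Qed.

(** A coordinate of a chart is an angle, or the height, up to sign and a
    constant. *)
Lemma pd_band (q : band -> R) (Q : 'rV[R]_m.+2 -> R) i a x d :
  (forall t : 'rV[R]_m.+2, `|t 0 0| <= l -> q (proj t) = Q t) -> range x ->
  is_derive (band_lift l i x) (delta_mx 0 a) Q d ->
  pd a (fun y => q (chart_inv i y)) x = axis_sign i a * d.
Proof.
move=> qQ Sx dQ.
have E y : range y -> q (chart_inv i y) = (Q \o band_lift l i) y.
  by move=> Sy; apply: qQ; exact: band_lift0_le.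
rewrite (pd_eq_on _ (right_open_half_space (@open_chart_box R m l)) E Sx).
apply: is_derive_pd.
pose L (v : 'rV[R]_m.+2) : 'rV[R]_m.+2 := \row_a (axis_sign i a * v 0 a).
have AL (h : R) : band_lift l i (h *: delta_mx 0 a + x) =
    h *: L (delta_mx 0 a) + band_lift l i x.
  by apply/rowP => b; rewrite !mxE; case: (eqVneq b 0) => [->|_]; ring.
have Le : L (delta_mx 0 a) = axis_sign i a *: delta_mx 0 a.
  by apply/rowP => b; rewrite !mxE; case: (eqVneq b a) => [->|_] //=;
    rewrite !mulr0.
have [H1 H2] := derive_affine Q AL.
have [D1 D2] := is_derive_scale (axis_sign i a) dQ.
by rewrite Le in H1 H2; split; [apply/H1|rewrite H2].
Qed.

End BandManifold.

(** * The unit of the Clifford algebra *)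

Section CliffordUnit.
Context {R : realType} {n : nat}.

Lemma symdiff0 (A : {set 'I_n}) :
  (symdiff finset.set0 A = A) * (symdiff A finset.set0 = A).
Proof. by split; rewrite /symdiff finset.set0D finset.setD0 ?finset.set0U ?finset.setU0. Qed.

Lemma clifford_sign0 (A : {set 'I_n}) :
  (clifford_sign R finset.set0 A = 1) * (clifford_sign R A finset.set0 = 1).
Proof.
split; rewrite /clifford_sign ?finset.set0I ?finset.setI0 finset.cards0 addn0.
  by rewrite (_ : [set _ | _]%SET = finset.set0) ?finset.cards0 //;
    apply/finset.setP => ab; rewrite !inE.
by rewrite (_ : [set _ | _]%SET = finset.set0) ?finset.cards0 //;
  apply/finset.setP => ab; rewrite !inE andbF.
Qed.

Lemma cmul1x (x : clifford R n) : cmul (cone R n) x = x.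
Proof.
apply/ffunP => C; rewrite ffunE (bigD1 finset.set0) //= [X in _ + X]big1 ?addr0.
  rewrite (eq_bigl (pred1 C)) => [|B]; last by rewrite symdiff0.
  by rewrite big_pred1_eq clifford_sign0 ffunE eqxx !mul1r.
move=> A A0; apply: big1 => B _.
by rewrite ffunE (negPf A0) mulr0 mul0r.
Qed.

Lemma cmulx1 (x : clifford R n) : cmul x (cone R n) = x.
Proof.
apply/ffunP => C; rewrite ffunE (bigD1 C) //= [X in _ + X]big1 ?addr0.
  rewrite (bigD1 finset.set0) ?symdiff0 //= big1 => [|B /andP[_ B0]].
    by rewrite clifford_sign0 ffunE eqxx mul1r mulr1 addr0.
  by rewrite ffunE (negPf B0) mulr0.
move=> A AC; apply: big1 => B; rewrite ffunE.
by case: (eqVneq B finset.set0) => [->|_]; rewrite ?mulr0 // symdiff0 (negPf AC).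
Qed.

Lemma Spin_lifts1 : Spin_lifts (cone R n) 1%:M.
Proof.
split; first by exists [::].
by move=> v; rewrite cmul1x cmulx1 trmx1 mulmx1.
Qed.

End CliffordUnit.

(** * The warped product metric on the band *)

Section BandMetric.
Context {R : realType} {m : nat}.
Variable l : R.
Hypothesis l_gt0 : 0 < l.
Local Notation band := (@band R m l).
Local Notation proj := (@band_proj R m l).
Local Notation M := (@band_manifold R m l l_gt0).
Local Notation dom := (@band_dom R m l).
Local Notation chart := (@band_chart R m l).
Local Notation chart_inv := (@band_chart_inv R m l).
Local Notation range := (@chart_range R m l).

Variables (r : R) (w h h' : R -> R).
Hypothesis l_lt_r : l < r.
Hypothesis w_gt0 : forall s, `|s| < r -> 0 < w s.
Hypothesis w_even : forall s, w (- s) = w s.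
Hypothesis w_smooth : forall k, Ck1 k [set s | `|s| < r] w.
Hypothesis dw : forall s : R, `|s| < r -> is_derive s 1 w (2 * h s * w s).
Hypothesis dh : forall s : R, `|s| < r -> is_derive s 1 h (h' s).

(** The same matrix in all charts, because these only differ by signs and
    constants. *)
Definition band_gram (i : chart_index M) (p : M) : 'M[R]_m.+2 :=
  warped_gram (w (height p)).

Let height_lt (p : band) : `|height p| < r.
Proof. exact: le_lt_trans (height_le l_gt0 p) l_lt_r. Qed.

Lemma warped_gram_quad (c : R) (v : 'rV[R]_m.+2) :
  (v *m warped_gram c *m v^T) 0 0 =
  \sum_a (if a == 0 then 1 else c) * v 0 a ^+ 2.
Proof.
rewrite mxE; apply: eq_bigr => a _.
by rewrite /warped_gram mul_mx_diag !mxE; case: ifP => _; ring.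
Qed.

Lemma band_gram_sym i p : dom i p -> (band_gram i p)^T = band_gram i p.
Proof. by move=> _; rewrite /band_gram tr_diag_mx. Qed.

Lemma band_gram_pos i p (v : 'rV[R]_m.+2) : dom i p -> v != 0 ->
  0 < (v *m band_gram i p *m v^T) 0 0.
Proof.
move=> _ v0; rewrite warped_gram_quad.
have c0 (a : 'I_m.+2) : 0 < (if a == 0 then 1 else w (height p)).
  by case: ifP => _; [exact: ltr01|exact: w_gt0].
have [a va] : exists a, v 0 a != 0.
  apply/existsP; apply: contraNT v0; rewrite negb_exists => /forallP v0.
  by apply/eqP/rowP => a; rewrite mxE; have := v0 a; rewrite negbK => /eqP.
rewrite (bigD1 a) //= ltr_wpDr //.
  by apply: sumr_ge0 => b _; rewrite mulr_ge0 ?sqr_ge0 // ltW.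
by rewrite mulr_gt0 // exprn_even_gt0.
Qed.

Lemma band_gram_smooth i (a b : 'I_m.+2) :
  smooth_on (chart i @` dom i) (fun x => band_gram i (chart_inv i x) a b).
Proof.
pose Q (t : 'rV[R]_m.+2) : R :=
  if a == b then (if a == 0 then 1 else w (t 0 0)) else 0.
pose O := [set t : 'rV[R]_m.+2 | `|t 0 0| < r].
have oO : open O by exact: open_coord_norm_lt.
apply: (@smooth_on_band _ _ _ l_gt0
  (fun p => warped_gram (w (height p)) a b) Q O i) => //.
- by move=> t tl; exact: le_lt_trans tl l_lt_r.
- move=> k; rewrite /Q; case: (a == b); last exact: Ck_cst.
  case: (a == 0); first exact: Ck_cst.
  apply: (Ck_comp1 oO _ _ (w_smooth k)) => //.
  by apply: Ck_sub (Ck_coord R 0 k).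
- by move=> t tl; rewrite warped_gramE height_proj clampE.
Qed.

Lemma band_gram_transition i j p : dom i p -> dom j p ->
  band_gram i p = @transition R m.+2 M i j p *m band_gram j p *m
    (@transition R m.+2 M i j p)^T.
Proof.
move=> ip jp; rewrite band_transition // tr_diag_mx !mulmx_diag.
congr diag_mx; apply/rowP => a; rewrite !mxE.
rewrite [RHS]mulrAC (_ : axis_sign i a * axis_sign j a * _ = 1) ?mul1r //.
by rewrite mulrACA !axis_sign_sq mulr1.
Qed.

Definition band_metric : metric M := @Defs.Metric R m.+2 M band_gram
  band_gram_sym band_gram_pos band_gram_smooth band_gram_transition.

(** Whichever end the coordinate 0 is measured from, as w is even. *)
Lemma band_gram_chart i x : range x ->
  band_gram i (chart_inv i x) = warped_gram (w (x 0 0 - l)).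
Proof.
move=> Sx; rewrite /band_gram height_chart_inv //.
by rewrite /axis_sign /=; case: i.1; rewrite ?expr1 ?expr0 ?mul1r // mulN1r w_even.
Qed.

Let range_height x : range x -> `|x 0 0 - l| < r.
Proof.
move=> [/half_spaceE x0 [x1 _]]; apply: le_lt_trans l_lt_r.
by rewrite ler_norml; lra.
Qed.

Let shift_derive (f : R -> R) (s d : R) :
  is_derive (s - l) 1 f d -> is_derive s 1 (fun s => f (s - l)) d.
Proof.
move=> df; have ds : is_derive (s : R) 1 (fun s : R => s - l) (1 : R).
  by apply: is_derive_eq; rewrite ?subr0.
by have := is_derive_comp1 ds df; rewrite mul1r.
Qed.

Lemma band_scal p : exists2 s, `|s| <= l & scal band_metric p =
  - (2 * m.+1%:R * h' s + (m.+1 * m.+2)%:R * h s ^+ 2).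
Proof.
pose i := band_chart_at p.
have ip : dom i p by exact: band_dom_chart_at.
have Sx := band_chart_in l_gt0 ip.
exists (chart i p 0 0 - l).
  by have [/half_spaceE x0 [x1 _]] := Sx; rewrite ler_norml; lra.
apply: (@scal_warped R m.+1 _ range (fun s => w (s - l)) (fun s => h (s - l))
  (fun s => h' (s - l))) => //.
- exact: right_open_half_space (@open_chart_box R m l).
- exact: band_gram_chart.
- by move=> x Sx'; rewrite gt_eqF // w_gt0 // range_height.
- by move=> x Sx'; apply: shift_derive; apply: dw; exact: range_height.
- by move=> x Sx'; apply: shift_derive; apply: dh; exact: range_height.
Qed.

Lemma band_boundary p : boundary M p -> `|height p| = l.
Proof.
move=> [a a0]; have -> : a = 0 by exact: val_inj.
rewrite /= mxE eqxx => /eqP; rewrite addrC addr_eq0 => /eqP E.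
rewrite -[LHS]mul1r -(norm_axis_sign (R := R) (band_chart_at p) 0) -normrM E.
by rewrite normrN gtr0_norm.
Qed.

Lemma band_mean_curvature p : boundary M p ->
  mean_curvature band_metric p = - h (- l).
Proof.
move=> [a a0]; have -> : a = 0 by exact: val_inj.
move=> /= x0; pose i := band_chart_at p.
have ip : dom i p by exact: band_dom_chart_at.
have Sx := band_chart_in l_gt0 ip.
have -> : - l = chart i p 0 0 - l by rewrite (x0 : chart i p 0 0 = 0) sub0r.
apply: (@mean_curvature_warped R m.+1 _ range (fun s => w (s - l))
  (fun s => h (s - l))) => //.
- exact: right_open_half_space (@open_chart_box R m l).
- exact: band_gram_chart.
- by move=> x Sx'; rewrite gt_eqF // w_gt0 // range_height.
- by move=> x Sx'; apply: shift_derive; apply: dw; exact: range_height.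
Qed.

Definition band_frame (i : chart_index M) (p : M) : 'M[R]_m.+2 :=
  diag_mx (\row_a (axis_sign i a *
    (if a == 0 then 1 else (Num.sqrt (w (height p)))^-1))).

Let sqrt_w_gt0 (p : band) : 0 < Num.sqrt (w (height p)).
Proof. by rewrite sqrtr_gt0 w_gt0. Qed.

Lemma band_frame_continuous i p : dom i p -> {for p, continuous (band_frame i)}.
Proof.
move=> _; apply: (@cvg_mx _ (nbhs p) (nbhs_filter p)) => a b.
have E q : band_frame i q a b = if a == b then axis_sign i a *
    (if a == 0 then 1 else (Num.sqrt (w (height q)))^-1) else 0.
  by rewrite !mxE; case: (a == b); rewrite ?mulr1n ?mulr0n.
under eq_fun do rewrite E; rewrite E.
case: (a == b); last exact: cvg_cst.
case: (a == 0); first exact: cvg_cst.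
apply: (@continuous_mulc _ _ _ (fun q : band => (Num.sqrt (w (height q)))^-1) p).
rewrite /prop_for /continuous_at; apply: cvgV.
  exact: (@nbhs_filter band p).
  by rewrite gt_eqF // sqrt_w_gt0.
apply: (@continuous_comp _ _ _ (fun q : band => w (height q)) Num.sqrt).
  apply: continuous_comp; first exact: continuous_height.
  by apply: (Ck1_cont (w_smooth 0)) => /=.
exact: sqrt_continuous.
Qed.

Lemma band_frame_orthonormal i p : dom i p ->
  band_frame i p *m band_gram i p *m (band_frame i p)^T = 1%:M.
Proof.
move=> _; rewrite tr_diag_mx !mulmx_diag -diag_const_mx.
congr diag_mx; apply/rowP => a; rewrite !mxE.
rewrite mulrAC mulrACA axis_sign_sq mul1r.
case: eqP => _; first by rewrite !mulr1.
have s0 := sqrt_w_gt0 p.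
rewrite -[X in _ * X](@sqr_sqrtr _ (w (height p))); last by rewrite ltW ?w_gt0.
by field; rewrite gt_eqF.
Qed.

Lemma band_frame_positive i p : dom i p -> 0 < \det (band_frame i p).
Proof.
move=> _; rewrite det_diag; under eq_bigr do rewrite mxE.
rewrite big_split /=.
have -> : \prod_(a < m.+2) (axis_sign i a : R) = 1.
  rewrite -[RHS](@prod_axis_sign R m i (false, i.2)); apply: eq_bigr => a _.
  by rewrite /axis_sign /=; case: ifP; rewrite ?expr0 mulr1.
rewrite mul1r; apply: prodr_gt0 => a _.
by case: eqP => _; rewrite ?ltr01 ?invr_gt0.
Qed.

Lemma band_frame_transition i j p : dom i p -> dom j p ->
  band_frame i p *m @transition R m.+2 M i j p *m invmx (band_frame j p) = 1%:M.
Proof.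
move=> ip jp; rewrite band_transition // mulmx_diag.
rewrite (_ : diag_mx _ = band_frame j p).
  by rewrite mulmxV // unitmxE unitfE gt_eqF // band_frame_positive.
congr diag_mx; apply/rowP => a; rewrite !mxE.
by rewrite mulrAC mulrA axis_sign_sq mul1r.
Qed.

(** The coordinate vector fields normalized to unit length, with the signs that
    make them independent of the chart, form a global frame. *)
Lemma band_spin : spin_structure band_metric.
Proof.
apply: (@SpinStructure R m.+2 M band_metric (chart_index M) dom id band_frame
  (fun _ _ _ => cone R m.+2)).
- by move=> p; exists (band_chart_at p); exact: band_dom_chart_at.
- exact: band_dom_open.
- by move=> i.
- exact: band_frame_continuous.
- exact: band_frame_orthonormal.
- exact: band_frame_positive.
- move=> k k' A p _ _; apply: (@cst_continuous band _ _ p).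
- by move=> i j p ip jp; rewrite /= band_frame_transition //; exact: Spin_lifts1.
- by move=> *; rewrite cmul1x.
Qed.

End BandMetric.

(** * Norms of bivectors *)

Section AreaContraction.
Context {R : realType}.

Lemma bivector_norm_warped n (c : R) (W : 'M[R]_n.+1) :
  bivector_norm (warped_gram c) W = Num.sqrt (2^-1 *
    \sum_j \sum_i (if i == 0 then 1 else c) * (if j == 0 then 1 else c) * W i j ^+ 2).
Proof.
rewrite /bivector_norm; congr (Num.sqrt (_ * _)); apply: eq_bigr => j _.
rewrite /warped_gram mul_mx_diag mxE mxE mulr_suml; apply: eq_bigr => i _.
by rewrite mul_mx_diag !mxE; case: ifP; case: ifP => _ _; ring.
Qed.

Lemma bivector_norm1 n (W : 'M[R]_n) :
  bivector_norm 1%:M W = Num.sqrt (2^-1 * \sum_j \sum_i W i j ^+ 2).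
Proof.
rewrite /bivector_norm !mulmx1; congr (Num.sqrt (_ * _)).
apply: eq_bigr => j _; rewrite mxE; apply: eq_bigr => i _.
by rewrite mxE expr2.
Qed.

(** Two distinct coordinate directions include one of the stretched ones, so
    that the area elements of the warped product are large as soon as one of
    the two lengths is. *)
Lemma warped_bivector_entry n (c : R) (W : 'M[R]_n.+1) i j :
  1 <= c -> W^T = - W -> bivector_norm (warped_gram c) W <= 1 ->
  c * W i j ^+ 2 <= 2.
Proof.
move=> c1 Wa; have c0 : 0 <= c by lra.
have f1 (k : 'I_n.+1) : 1 <= (if k == 0 then 1 else c) by case: ifP.
have f0 (k : 'I_n.+1) : 0 <= (if k == 0 then 1 else c) by apply: le_trans (f1 k).
have [->|ij] := eqVneq i j.
  have : W j j = - W j j by have := congr1 (fun A : 'M[R]_n.+1 => A j j) Wa; rewrite !mxE.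
  move=> /eqP; rewrite eq_sym -subr_eq0 -opprD oppr_eq0 -mulr2n mulrn_eq0 /=.
  by move=> /eqP ->; rewrite expr0n mulr0.
rewrite bivector_norm_warped => H.
rewrite -[X in _ <= X]sqrtr1 ler_sqrt // in H.
have {}H : \sum_j0 \sum_i0 (if i0 == 0 then 1 else c) *
   (if j0 == 0 then 1 else c) * W i0 j0 ^+ 2 <= 2 by lra.
have g0 k k' : 0 <= (if k == 0 then 1 else c) * (if k' == 0 then 1 else c) *
    W k k' ^+ 2.
  by apply: mulr_ge0; [exact: mulr_ge0|exact: sqr_ge0].
apply: le_trans H; rewrite (bigD1 j) //= (bigD1 i) //= -addrA.
rewrite ler_wpDr //.
  apply: addr_ge0; first by apply: sumr_ge0 => k _; exact: g0.
  by apply: sumr_ge0 => k _; apply: sumr_ge0 => k' _; exact: g0.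
rewrite ler_wpM2r ?sqr_ge0 //; move: ij.
case: (eqVneq i 0) => [->|_]; case: (eqVneq j 0) => [jE|_];
  rewrite ?jE ?eqxx ?mul1r ?mulr1 // => _.
by rewrite ler_peMl.
Qed.

(** The entries of W are at most (2 / c)^(1/2), so those of its image are
    O (c^(-1/2)) for a fixed bound B on the differential. *)
Lemma bivector_map_contraction n k (c B : R) (D : 'M[R]_(n.+1, k)) (W : 'M[R]_n.+1) :
  1 <= c -> (k%:R * (n.+1 * n.+1)%:R * B ^+ 2) ^+ 2 <= c ->
  (forall i j, `|D i j| <= B) -> W^T = - W ->
  bivector_norm (warped_gram c) W <= 1 ->
  bivector_norm 1%:M (bivector_map D W) <= 1.
Proof.
move=> c1 Bc DB Wa Wn; rewrite bivector_norm1 -[leRHS]sqrtr1 ler_wsqrtr //.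
have c0 : 0 < c by lra.
pose mu := Num.sqrt (2 / c).
have mu2 : mu ^+ 2 = 2 / c by rewrite sqr_sqrtr // divr_ge0 // ltW.
have Wmu i j : `|W i j| <= mu.
  rewrite -sqrtr_sqr ler_wsqrtr // ler_pdivlMr // mulrC.
  exact: warped_bivector_entry Wn.
have E a b : `|bivector_map D W a b| <= (n.+1 * n.+1)%:R * B ^+ 2 * mu.
  rewrite /bivector_map mxE; apply: le_trans (ler_norm_sum _ _ _) _.
  have -> : (n.+1 * n.+1)%:R * B ^+ 2 * mu = \sum_(j < n.+1) (n.+1%:R * B * mu * B).
    by rewrite sum_const_ord natrM; ring.
  apply: ler_sum => j _; rewrite normrM ler_pM // mxE.
  apply: le_trans (ler_norm_sum _ _ _) _.
  have -> : n.+1%:R * B * mu = \sum_(i < n.+1) (B * mu) by rewrite sum_const_ord; ring.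
  by apply: ler_sum => i _; rewrite normrM ler_pM // mxE.
have B0 : 0 <= (n.+1 * n.+1)%:R * B ^+ 2 * mu.
  by apply: mulr_ge0; [apply: mulr_ge0; [exact: ler0n|exact: sqr_ge0]|
    exact: sqrtr_ge0].
apply: (@le_trans _ _ (2^-1 * \sum_(j < k) \sum_(i < k)
    ((n.+1 * n.+1)%:R * B ^+ 2 * mu) ^+ 2)).
  rewrite ler_pM2l ?invr_gt0 //; apply: ler_sum => b _; apply: ler_sum => a _.
  by rewrite -[leLHS]real_normK ?num_real // ler_pXn2r ?nnegrE.
rewrite !sum_const_ord exprMn mu2.
rewrite [leLHS](_ : _ = (k%:R * (n.+1 * n.+1)%:R * B ^+ 2) ^+ 2 / c).
  by rewrite ler_pdivrMr // mul1r.
by field; rewrite gt_eqF.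
Qed.

End AreaContraction.

(** * Inverse stereographic projection *)

Section Stereographic.
Context {R : realType} {n : nat}.
Implicit Types (b : R) (W : 'rV[R]_n).

Definition sqnorm W : R := \sum_a W 0 a ^+ 2.

(** The inverse stereographic projection of W / b: the origin goes to the unit
    vector e_0 and the point at infinity, b = 0, to - e_0. *)
Definition inv_stereo b W : 'rV[R]_n.+1 :=
  \row_k if unlift 0 k is Some a then 2 * b * W 0 a / (b ^+ 2 + sqnorm W)
         else (b ^+ 2 - sqnorm W) / (b ^+ 2 + sqnorm W).

Lemma inv_stereo0 b W :
  inv_stereo b W 0 0 = (b ^+ 2 - sqnorm W) / (b ^+ 2 + sqnorm W).
Proof. by rewrite mxE unlift_none. Qed.

Lemma inv_stereoS b W a :
  inv_stereo b W 0 (lift 0 a) = 2 * b * W 0 a / (b ^+ 2 + sqnorm W).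
Proof. by rewrite mxE liftK. Qed.

Lemma sqnorm_ge0 W : 0 <= sqnorm W.
Proof. by apply: sumr_ge0 => a _; exact: sqr_ge0. Qed.

Lemma sqnorm_eq0 W : sqnorm W = 0 -> W = 0.
Proof.
move=> W0; apply/rowP => a; rewrite mxE; apply/eqP; rewrite -sqrf_eq0.
apply: contra_eqT W0 => Wa; rewrite gt_eqF // /sqnorm (bigD1 a) //= ltr_wpDr //.
  by apply: sumr_ge0 => k _; exact: sqr_ge0.
by rewrite lt_neqAle eq_sym Wa sqr_ge0.
Qed.

Lemma dot_inv_stereo b W : 0 < b ^+ 2 + sqnorm W ->
  dot (inv_stereo b W) (inv_stereo b W) = 1.
Proof.
move=> d0; have d1 := lt0r_neq0 d0.
rewrite /dot mxE sum_ord0 inv_stereo0 mxE inv_stereo0.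
under eq_bigr do rewrite inv_stereoS mxE inv_stereoS.
have -> : \sum_a 2 * b * W 0 a / (b ^+ 2 + sqnorm W) *
    (2 * b * W 0 a / (b ^+ 2 + sqnorm W)) =
    (2 * b / (b ^+ 2 + sqnorm W)) ^+ 2 * sqnorm W.
  by rewrite /sqnorm mulr_sumr; apply: eq_bigr => a _; ring.
by move: (sqnorm W) d1 => q d1; field.
Qed.

Lemma inv_stereo_inf W : 0 < sqnorm W -> inv_stereo 0 W = - delta_mx 0 0.
Proof.
move=> q0; apply/rowP => k; rewrite [RHS]mxE [in RHS]mxE.
case: (unliftP 0 k) => [a|] ->.
  by rewrite inv_stereoS mulr0 !mul0r oppr0.
by rewrite inv_stereo0 expr0n /= !add0r mulNr divff ?gt_eqF.
Qed.

Lemma inv_stereo_e0 b W : 0 < b ^+ 2 + sqnorm W ->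
  inv_stereo b W = delta_mx 0 0 -> W = 0.
Proof.
move=> d0 E; apply: sqnorm_eq0.
have := congr1 (fun z : 'rV[R]_n.+1 => z 0 0) E; rewrite inv_stereo0 mxE !eqxx /=.
move=> /(congr1 (fun s => s * (b ^+ 2 + sqnorm W))).
by rewrite divfK ?gt_eqF // mul1r; lra.
Qed.

Lemma inv_stereo_0 b : b != 0 -> inv_stereo b 0 = delta_mx 0 0.
Proof.
move=> b0; have q0 : sqnorm 0 = 0.
  by rewrite /sqnorm big1 // => a _; rewrite mxE expr0n.
apply/rowP => k; rewrite [RHS]mxE; case: (unliftP 0 k) => [a|] ->.
  by rewrite inv_stereoS mxE mulr0 mul0r.
by rewrite inv_stereo0 q0 subr0 addr0 divff ?expf_neq0.
Qed.

End Stereographic.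

(** * The map from the band to the sphere *)

Section BandMap.
Context {R : realType} {m : nat}.
Variable l : R.
Hypothesis l_gt0 : 0 < l.
Variable delta : R.
Hypothesis delta_gt0 : 0 < delta.
Hypothesis delta_lt : delta < l.
Local Notation band := (@band R m l).
Local Notation proj := (@band_proj R m l).
Local Notation M := (@band_manifold R m l l_gt0).
Local Notation dom := (@band_dom R m l).
Local Notation chart := (@band_chart R m l).
Local Notation chart_inv := (@band_chart_inv R m l).
Local Notation range := (@chart_range R m l).
Implicit Types (t : 'rV[R]_m.+2) (p : band) (a b : 'I_m.+2).

Definition bump (s : R) : R := flat 0 (delta ^+ 2 - s ^+ 2).

Lemma bump0_gt0 : 0 < bump 0.
Proof. by apply: flat_gt0; rewrite expr0n subr0 exprn_gt0. Qed.

Lemma bump_eq0 s : delta <= `|s| -> bump s = 0.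
Proof.
move=> ds; apply: flat_eq0; rewrite subr_le0 -[leRHS]real_normK ?num_real //.
by rewrite ler_pXn2r ?nnegrE // ltW.
Qed.

(** A map of the band to R^n, n = m + 2, in terms of the height and of the
    coordinates of the points of the circles.  On the torus at height 0, the
    sines vanish at 2^(n-1) points; the correction of the height by the cosines
    leaves a single zero in the band. *)
Definition sine_map (h : R) (c s : 'I_m.+2 -> R) : 'rV[R]_m.+2 :=
  \row_a if a == 0 then h + l * \sum_(b | b != 0) (1 - c b) else s a.

Definition angle_map t : 'rV[R]_m.+3 :=
  inv_stereo (bump (t 0 0))
    (sine_map (t 0 0) (fun b => cos (t 0 b)) (fun b => sin (t 0 b))).

Definition sphere_map (p : band) : 'rV[R]_m.+3 :=
  inv_stereo (bump (height p))
    (sine_map (height p) (fun b => circle_cos b p) (fun b => circle_sin b p)).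

Local Notation sines t :=
  (sine_map (t 0 0) (fun b => cos (t 0 b)) (fun b => sin (t 0 b))).
Local Notation denom t := (bump (t 0 0) ^+ 2 + sqnorm (sines t)).

Lemma sine_map_proj t : `|t 0 0| <= l ->
  sine_map (height (proj t)) (fun b => circle_cos b (proj t))
    (fun b => circle_sin b (proj t)) = sines t.
Proof.
move=> tl; rewrite height_proj clampE //; apply/rowP => a; rewrite !mxE.
case: eqVneq => [_|a0]; last by rewrite circle_sin_proj.
by congr (_ + _ * _); apply: eq_bigr => b b0; rewrite circle_cos_proj.
Qed.

Lemma sphere_map_proj t : `|t 0 0| <= l -> sphere_map (proj t) = angle_map t.
Proof.
by move=> tl; rewrite /sphere_map sine_map_proj // height_proj clampE.
Qed.

(** If a cosine is -1, the sum of the 1 - cos is at least 2, and the height would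
    be at most - 2 l.  The margin up to 2 l makes the map smooth on an open set
    containing the closed strip. *)
Lemma sine_map_eq0 t : `|t 0 0| < 2 * l -> sines t = 0 ->
  t 0 0 = 0 /\ forall a, a != 0 -> cos (t 0 a) = 1.
Proof.
move=> tl /rowP W0.
have s0 a : a != 0 -> sin (t 0 a) = 0.
  by move=> a0; have := W0 a; rewrite !mxE (negPf a0).
have c01 a : a != 0 -> cos (t 0 a) = 1 \/ cos (t 0 a) = -1.
  move=> a0; have := cos2Dsin2 (t 0 a); rewrite s0 // expr0n addr0 => /eqP.
  by rewrite sqrf_eq1 => /orP[] /eqP; [left|right].
have h0 : t 0 0 + l * \sum_(b | b != 0) (1 - cos (t 0 b)) = 0.
  by have := W0 0; rewrite !mxE eqxx.
have ge0 b : 0 <= 1 - cos (t 0 b) by rewrite subr_ge0 cos_le1.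
have c1 a : a != 0 -> cos (t 0 a) = 1.
  move=> a0; have [//|ca] := c01 a a0.
  have : 2 <= \sum_(b | b != 0) (1 - cos (t 0 b)).
    rewrite (bigD1 a) //= ca opprK.
    have : 0 <= \sum_(b | (b != 0) && (b != a)) (1 - cos (t 0 b)).
      by apply: sumr_ge0 => b _; exact: ge0.
    by lra.
  rewrite -(ler_pM2l l_gt0); move: tl; rewrite ltr_norml => /andP[tl _].
  by move: h0 tl; set S := l * _; lra.
split=> //; move: h0; rewrite big1 ?mulr0 ?addr0 // => b b0.
by rewrite c1 // subrr.
Qed.

Lemma angle_map_denom t : `|t 0 0| < 2 * l -> 0 < denom t.
Proof.
move=> tl; have q0 := sqnorm_ge0 (sines t).
have [W0|] := eqVneq (sqnorm (sines t)) 0; last first.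
  by move=> W0; rewrite ltr_wpDl ?sqr_ge0 // lt_neqAle eq_sym W0.
have [t0 _] := sine_map_eq0 tl (sqnorm_eq0 W0).
by rewrite W0 addr0 t0 exprn_gt0 // bump0_gt0.
Qed.

Definition wide_strip : set 'rV[R]_m.+2 := [set t | `|t 0 0| < 2 * l].

Lemma open_wide_strip : open wide_strip.
Proof. exact: open_coord_norm_lt. Qed.

Lemma Ck_comp_coord (O : set 'rV[R]_m.+2) (g : R -> R) a k :
  open O -> Ck1 k setT g -> Ck k O (fun t => g (t 0 a)).
Proof.
move=> oO Cg; apply: (Ck_comp1 (f := fun t : 'rV[R]_m.+2 => t 0 a) oO _ _ Cg) => //.
by apply: Ck_sub (Ck_coord R a k).
Qed.

Lemma Ck_bump (O : set 'rV[R]_m.+2) k : open O -> Ck k O (fun t => bump (t 0 0)).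
Proof.
move=> oO; have Cc : Ck k O (fun t => t 0 0) by apply: Ck_sub (Ck_coord R 0 k).
have H := Ck_sub_fun oO (Ck_cst k O (delta ^+ 2)) (Ck_mul oO Cc Cc).
have := Ck_comp1 (I := setT) oO (fun _ _ => I) H (Ck1_flat k 0).
by apply: (Ck_ext oO) => t _; rewrite /= /bump expr2.
Qed.

Lemma Ck_sine_map (O : set 'rV[R]_m.+2) a k : open O -> Ck k O (fun t => sines t 0 a).
Proof.
move=> oO; case: (eqVneq a 0) => [->|a0]; last first.
  by apply: (Ck_ext oO _ (Ck_comp_coord a oO (Ck1_sin k))) => t _;
    rewrite mxE (negPf a0).
have Cc : Ck k O (fun t => t 0 0) by apply: Ck_sub (Ck_coord R 0 k).
have Cs : Ck k O (fun t => \sum_(b | b != 0) (1 - cos (t 0 b))).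
  apply: Ck_sum => // b _; apply: Ck_sub_fun => //; first exact: Ck_cst.
  exact: Ck_comp_coord (Ck1_cos k).
apply: (Ck_ext oO _ (Ck_add oO Cc (Ck_mul oO (Ck_cst k O l) Cs))) => t _.
by rewrite mxE eqxx.
Qed.

Lemma Ck_sqnorm_sines (O : set 'rV[R]_m.+2) k :
  open O -> Ck k O (fun t => sqnorm (sines t)).
Proof.
move=> oO; apply: Ck_sum => // a _; have Cw := Ck_sine_map a k oO.
by apply: (Ck_ext oO _ (Ck_mul oO Cw Cw)) => t _; rewrite expr2.
Qed.

Lemma Ck_inv_denom k : Ck k wide_strip (fun t => (denom t)^-1).
Proof.
have oO := open_wide_strip; have Cq := Ck_sqnorm_sines k oO.
have Cb := Ck_bump k oO.
have Cd : Ck k wide_strip (fun t => denom t).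
  by apply: (Ck_ext oO _ (Ck_add oO (Ck_mul oO Cb Cb) Cq)) => t _; rewrite expr2.
apply: (Ck_comp1 oO _ Cd (Ck1_inv k)) => t tl /=.
by rewrite gt_eqF // angle_map_denom.
Qed.

(** The factor by which the coordinates of the map to the sphere other than the
    first are proportional to those of the map to R^n. *)
Definition stereo_factor t : R := 2 * bump (t 0 0) * (denom t)^-1.

Lemma Ck_stereo_factor k : Ck k wide_strip stereo_factor.
Proof.
have oO := open_wide_strip.
exact: (Ck_mul oO (Ck_mul oO (Ck_cst k _ 2) (Ck_bump k oO)) (Ck_inv_denom k)).
Qed.

Lemma angle_mapS t a : angle_map t 0 (lift 0 a) = sines t 0 a * stereo_factor t.
Proof. by rewrite inv_stereoS /stereo_factor; ring. Qed.

Lemma Ck_angle_map k (b : 'I_m.+3) : Ck k wide_strip (fun t => angle_map t 0 b).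
Proof.
have oO := open_wide_strip; have Cq := Ck_sqnorm_sines k oO.
have Cb := Ck_bump k oO.
case: (unliftP 0 b) => [a|] ->.
  apply: (Ck_ext oO _ (Ck_mul oO (Ck_sine_map a k oO) (Ck_stereo_factor k))).
  by move=> t _; rewrite angle_mapS.
have H := Ck_mul oO (Ck_sub_fun oO (Ck_mul oO Cb Cb) Cq) (Ck_inv_denom k).
by apply: (Ck_ext oO _ H) => t _; rewrite inv_stereo0 expr2.
Qed.

Let strip_wide t : `|t 0 0| <= l -> wide_strip t.
Proof. by move=> tl; rewrite /wide_strip /=; have := l_gt0; lra. Qed.

Let denom_band p : 0 < bump (height p) ^+ 2 +
  sqnorm (sine_map (height p) (fun b => circle_cos b p) (fun b => circle_sin b p)).
Proof.
have [t [tl _ ->]] := band_projP l_gt0 p.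
rewrite sine_map_proj // height_proj clampE //.
exact: angle_map_denom (strip_wide tl).
Qed.

Lemma sphere_map_smooth : @smooth_sphere_map R m.+2 M sphere_map.
Proof.
split=> [p|i b]; first by apply: dot_inv_stereo; exact: denom_band.
apply: (@smooth_on_band _ _ _ l_gt0 (fun p => sphere_map p 0 b)
  (fun t => angle_map t 0 b) wide_strip i).
- exact: open_wide_strip.
- exact: strip_wide.
- by move=> k; exact: Ck_angle_map.
- by move=> t tl; rewrite sphere_map_proj.
Qed.

Lemma angle_map_const t : `|t 0 0| < 2 * l -> delta <= `|t 0 0| ->
  angle_map t = - delta_mx 0 0.
Proof.
move=> tl td; rewrite /angle_map bump_eq0 // inv_stereo_inf //.
by have := angle_map_denom tl; rewrite bump_eq0 // expr0n add0r.
Qed.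

Lemma sphere_map_const p : delta <= `|height p| -> sphere_map p = - delta_mx 0 0.
Proof.
have [t [tl _ ->]] := band_projP l_gt0 p; rewrite height_proj clampE // => td.
rewrite sphere_map_proj // angle_map_const //; exact: strip_wide.
Qed.

Lemma sphere_map_locally_constant :
  @locally_constant_near_boundary R m.+2 M sphere_map.
Proof.
have oU : open [set p : band | delta < `|height p|].
  apply: (@open_comp _ _ (fun p : band => `|height p|) [set s | delta < s]).
    by move=> p _; exact: continuous_norm_height.
  exact: open_gt.
exists [set p : band | delta < `|height p|]; split=> //.
  by move=> p /band_boundary /= ->.
move=> p /= pd; have : \forall q \near p, delta < `|height q|.
  by apply: open_nbhs_nbhs; split.
by apply: filterS => q qd; rewrite !sphere_map_const // ltW.
Qed.

Definition chart_angles p : 'rV[R]_m.+2 :=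
  band_lift l (band_chart_at p) (chart (band_chart_at p) p).

Lemma chart_anglesK p : proj (chart_angles p) = p.
Proof. exact: (band_chartK l_gt0 (band_dom_chart_at l_gt0 p)). Qed.

Lemma chart_angles0 p : `|chart_angles p 0 0| <= l.
Proof. by apply: band_lift0_le; apply: band_chart_in => //; exact: band_dom_chart_at. Qed.

Lemma chart_angles0E p : chart_angles p 0 0 = height p.
Proof. by rewrite -[in RHS](chart_anglesK p) height_proj clampE // chart_angles0. Qed.

Lemma chart_angles_le p a : a != 0 -> `|chart_angles p 0 a| <= 2 * pi.
Proof.
move=> a0; have [_ [_ /(_ a a0) xa]] := band_chart_in l_gt0 (band_dom_chart_at l_gt0 p).
rewrite mxE (negPf a0); apply: le_trans (ler_normD _ _) _.
rewrite normrM norm_axis_sign mul1r normrM normr_nat (ger0_norm (pi_ge0 R)).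
have := pi_ge0 R; case: ((band_chart_at p).2 a); rewrite ?mul1r ?mul0r; lra.
Qed.

Lemma differential_sphere_map p a (b : 'I_m.+3) d :
  is_derive (chart_angles p) (delta_mx 0 a) (fun t => angle_map t 0 b) d ->
  @differential R m.+2 M sphere_map p a b = axis_sign (band_chart_at p) a * d.
Proof.
move=> dQ; rewrite mxE.
apply: (@pd_band _ _ _ (fun q => sphere_map q 0 b) (fun t => angle_map t 0 b)) => //.
  by move=> t tl; rewrite sphere_map_proj.
by apply: band_chart_in => //; exact: band_dom_chart_at.
Qed.

Lemma angle_map_derive t a (b : 'I_m.+3) : wide_strip t ->
  is_derive t (delta_mx 0 a) (fun t => angle_map t 0 b)
    ('D_(delta_mx 0 a) (fun t => angle_map t 0 b) t).
Proof.
by move=> tl; apply: derivableP; apply: (Ck_derivable (fun k => Ck_angle_map k b)).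
Qed.

(** The angles chosen by the charts stay in a compact box, on which the partial
    derivatives are bounded.  The charts and the map do not involve the metric,
    so neither does the bound, and the size of the torus can be chosen after
    it. *)
Lemma differential_bounded :
  exists B : R, forall p a (b : 'I_m.+3), `|@differential R m.+2 M sphere_map p a b| <= B.
Proof.
pose K := [set t : 'rV[R]_m.+2 | forall a,
  (if a == 0 then `[- l, l]%classic else `[- (2 * pi), 2 * pi]%classic : set R) (t 0 a)].
have cK : compact K.
  apply: (@rV_compact R m.+2 (fun a => if a == 0 then `[- l, l]%classic
    else `[- (2 * pi), 2 * pi]%classic)) => a.
  by case: ifP => _; exact: segment_compact.
have K_angles p : K (chart_angles p).
  move=> a /=; case: eqVneq => [->|a0]; rewrite /= in_itv /= -ler_norml.
    exact: chart_angles0.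
  exact: chart_angles_le.
have K0 : K !=set0 by exists (chart_angles (proj 0)); exact: K_angles.
have Kwide t : K t -> wide_strip t.
  by move=> /(_ 0) /=; rewrite in_itv /= -ler_norml => /strip_wide.
have H (ab : 'I_m.+2 * 'I_m.+3) : exists B : R, forall t, K t ->
    `|'D_(delta_mx 0 ab.1) (fun t => angle_map t 0 ab.2) t| <= B.
  have cD : {within K, continuous
      (fun t => `|'D_(delta_mx 0 ab.1) (fun t => angle_map t 0 ab.2) t|)}.
    apply: continuous_in_subspaceT => t /set_mem Kt.
    apply: (@continuous_comp _ _ _
      (fun t => 'D_(delta_mx 0 ab.1) (fun t => angle_map t 0 ab.2) t) Num.norm).
      have := Ck_derive (delta_mx 0 ab.1) (fun k => Ck_angle_map k ab.2) 0.
      by move/Ck_cont; apply; exact: Kwide.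
    exact: norm_continuous.
  have [c _ cB] := EVT_max_rV K0 cK cD.
  by eexists => t Kt; apply: cB; exact: mem_set.
have [B HB] := choice H.
exists (\sum_ab `|B ab|) => p a b; have tl := strip_wide (chart_angles0 p).
rewrite (differential_sphere_map (angle_map_derive a b tl)).
rewrite normrM norm_axis_sign mul1r.
apply: le_trans (HB (a, b) _ (K_angles p)) _.
rewrite (bigD1 (a, b)) //=; apply: le_trans (ler_norm _) _.
by rewrite lerDl sumr_ge0.
Qed.

Lemma supp_differential_height p :
  @supp_differential R m.+2 M sphere_map p -> `|height p| <= delta.
Proof.
have cC : closed [set q : band | `|height q| <= delta].
  apply: (@closed_comp _ _ (fun q : band => `|height q|) [set s | s <= delta]).
    by move=> q _; exact: continuous_norm_height.
  exact: closed_le.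
suff : [set q | @differential R m.+2 M sphere_map q != 0] `<=`
       [set q : band | `|height q| <= delta].
  by move=> H /(closure_subset H); rewrite -(closure_id _).1.
move=> q /= dq; rewrite leNgt; apply: contraNN dq => qd.
apply/eqP/matrixP => a b; rewrite [RHS]mxE -[RHS](mulr0 (axis_sign (band_chart_at q) a)).
apply: differential_sphere_map.
apply: (@near_eq_is_derive R 'rV[R]_m.+2 R (cst ((- delta_mx 0 0 : 'rV[R]_m.+3) 0 b))).
have : \forall t \near chart_angles q,
    `|(t : 'rV[R]_m.+2) 0 0| < 2 * l /\ delta < `|t 0 0|.
  apply: filterI.
    apply: open_nbhs_nbhs; split; first exact: open_wide_strip.
    exact/strip_wide/chart_angles0.
  have cn : (fun t : 'rV[R]_m.+2 => `|t 0 0|) @ chart_angles q --> `|chart_angles q 0 0|.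
    apply: (@continuous_comp _ _ _ (fun t : 'rV[R]_m.+2 => t 0 0) Num.norm).
      exact: coord_continuous.
    exact: norm_continuous.
  apply: (cn [set s | delta < s]); apply: open_nbhs_nbhs; split; first exact: open_gt.
  by rewrite /= chart_angles0E.
by apply: filterS => t [t1 t2]; rewrite angle_map_const // ltW.
Qed.

Definition base_point : band := proj 0.

Lemma sphere_map_base p : sphere_map p = delta_mx 0 0 -> p = base_point.
Proof.
move=> pE; have W0 := inv_stereo_e0 (denom_band p) pE.
have [t [tl _ tE]] := band_projP l_gt0 p.
rewrite tE sine_map_proj // in W0.
have [t0 ta] := sine_map_eq0 (strip_wide tl) W0.
rewrite tE; apply: eq_band_proj => [|a a0]; first by rewrite t0 mxE.
rewrite ta // mxE cos0 sin0; split=> //.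
by have /rowP/(_ a) := W0; rewrite !mxE (negPf a0).
Qed.

Lemma height_base : height base_point = 0.
Proof. by rewrite height_proj mxE clampE // normr0 ltW. Qed.

Lemma cos_chart_angles_base a : a != 0 -> cos (chart_angles base_point 0 a) = 1.
Proof.
move=> a0; rewrite -(circle_cos_proj l _ a0) chart_anglesK circle_cos_proj //.
by rewrite mxE cos0.
Qed.

Lemma sin_chart_angles_base a : a != 0 -> sin (chart_angles base_point 0 a) = 0.
Proof.
move=> a0; rewrite -(circle_sin_proj l _ a0) chart_anglesK circle_sin_proj //.
by rewrite mxE sin0.
Qed.

Lemma sines_chart_angles_base : sines (chart_angles base_point) = 0.
Proof.
apply/rowP => a; rewrite [LHS]mxE [RHS]mxE; case: eqVneq => [_|a0]; last first.
  exact: sin_chart_angles_base.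
rewrite chart_angles0E height_base add0r big1 ?mulr0 // => b b0.
by rewrite cos_chart_angles_base // subrr.
Qed.

Lemma sphere_map_base_point : sphere_map base_point = delta_mx 0 0.
Proof.
rewrite -(chart_anglesK base_point) sphere_map_proj ?chart_angles0 //.
rewrite /angle_map sines_chart_angles_base inv_stereo_0 //.
by rewrite chart_angles0E height_base gt_eqF // bump0_gt0.
Qed.

(** The correction of the height is critical where all the angles are 0, so the
    differential of the map to R^n is the identity there. *)
Lemma is_derive_sines_base a b : is_derive (chart_angles base_point)
  (delta_mx 0 a) (fun t => sines t 0 b) (a == b)%:R.
Proof.
set x := chart_angles base_point; set e := delta_mx 0 a.
have dc k : is_derive x e (fun t => cos (t 0 k)) ((a == k)%:R * - sin (x 0 k)).
  have := is_derive_comp1 (is_derive_coord k x e) (is_derive_cos (x 0 k)).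
  by rewrite [X in X * _]mxE eqxx /= [k == a]eq_sym.
have [->|b0] := eqVneq b 0.
  have -> : (fun t => sines t 0 0) =
      (fun t => t 0 0) + l *: (fun t => \sum_(k | k != 0) (1 - cos (t 0 k))).
    by apply/funext => t; rewrite mxE eqxx.
  have dS : is_derive x e (fun t : 'rV[R]_m.+2 => \sum_(k | k != 0) (1 - cos (t 0 k))) 0.
    have dk k : is_derive x e (fun t : 'rV[R]_m.+2 =>
        if k != 0 then 1 - cos (t 0 k) else 0) 0.
      case: (eqVneq k 0) => [_|k0] /=; first exact: is_derive_cst.
      have := @is_deriveB _ _ _ _ _ _ _ _ _ (is_derive_cst (1 : R) x e) (dc k).
      rewrite sin_chart_angles_base // oppr0 mulr0 subr0; exact.
    have -> : (fun t : 'rV[R]_m.+2 => \sum_(k | k != 0) (1 - cos (t 0 k))) =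
       \sum_k (fun t : 'rV[R]_m.+2 => if k != 0 then 1 - cos (t 0 k) else 0).
      by apply/funext => t; rewrite fct_sumE big_mkcond.
    by apply: is_derive_eq (@is_derive_sum _ _ _ _ _ _ _ _ dk) _; exact: big1.
  have d0 := is_derive_coord 0 x e.
  have := is_deriveD d0 (is_deriveZ l dS).
  by rewrite scaler0 addr0 [X in is_derive _ _ _ X]mxE eqxx /= eq_sym.
have -> : (fun t => sines t 0 b) = (fun t => sin (t 0 b)).
  by apply/funext => t; rewrite mxE (negPf b0).
have := is_derive_comp1 (is_derive_coord b x e) (is_derive_sin (x 0 b)).
by rewrite cos_chart_angles_base // mulr1 [X in is_derive _ _ _ X]mxE eqxx /= eq_sym.
Qed.

Lemma stereo_factor_base : 0 < stereo_factor (chart_angles base_point).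
Proof.
rewrite /stereo_factor sines_chart_angles_base chart_angles0E height_base.
rewrite (_ : sqnorm 0 = 0) ?addr0; last first.
  by rewrite /sqnorm big1 // => a _; rewrite mxE expr0n.
by rewrite !mulr_gt0 ?invr_gt0 ?exprn_gt0 ?bump0_gt0.
Qed.

(** The map is the product of the map to R^n, which vanishes at this point, by a
    positive function. *)
Lemma differential_base a b :
  @differential R m.+2 M sphere_map base_point a (lift 0 b) =
  axis_sign (band_chart_at base_point) a *
    (stereo_factor (chart_angles base_point) * (a == b)%:R).
Proof.
set x := chart_angles base_point; set e : 'rV[R]_m.+2 := delta_mx 0 a.
apply: differential_sphere_map.
have xw : wide_strip x by exact/strip_wide/chart_angles0.
have dK : is_derive x e stereo_factor ('D_e stereo_factor x).
  by apply: derivableP; apply: (Ck_derivable (fun k => Ck_stereo_factor k)).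
have -> : (fun t => angle_map t 0 (lift 0 b)) =
    (fun t => sines t 0 b) * stereo_factor.
  by apply/funext => t; rewrite angle_mapS.
have := is_deriveM (is_derive_sines_base a b) dK.
by rewrite sines_chart_angles_base [X in X *: _]mxE scale0r add0r.
Qed.

Lemma differential_base_unit :
  rsubmx (@differential R m.+2 M sphere_map base_point : 'M[R]_(m.+2, 1 + m.+2))
    \in unitmx.
Proof.
rewrite (_ : rsubmx _ = diag_mx (\row_a (axis_sign (band_chart_at base_point) a *
    stereo_factor (chart_angles base_point)))).
  rewrite unitmxE unitfE det_diag; apply/prodf_neq0 => a _; rewrite mxE.
  apply: mulf_neq0; last by rewrite gt_eqF // stereo_factor_base.
  by rewrite -normr_eq0 norm_axis_sign oner_eq0.
apply/matrixP => a b; rewrite [LHS]mxE (_ : rshift 1 b = lift 0 b); last first.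
  exact: val_inj.
rewrite differential_base !mxE mulrA.
by case: (a == b); rewrite ?mulr1 ?mulr0 ?mulr1n ?mulr0n.
Qed.

(** The value e_0 is only taken at the base point, where the differential is
    invertible; the degree is the local degree there. *)
Lemma sphere_map_degree :
  exists2 d : int, d != 0 & @has_degree R m.+2 M sphere_map d.
Proof.
pose D : 'M[R]_(m.+2, 1 + m.+2) := @differential R m.+2 M sphere_map base_point.
have uD : rsubmx D \in unitmx := differential_base_unit.
exists (@local_degree R m.+2 M sphere_map base_point).
  rewrite /local_degree sgz_eq0 sphere_map_base_point -/D.
  have E : \det (col_mx (delta_mx 0 0 : 'rV[R]_(1 + m.+2)) D : 'M[R]_(1 + m.+2)) =
      \det (rsubmx D).
    rewrite -[RHS]mul1r -(det1 R 1) -(@det_lblock R 1 m.+2 1%:M (lsubmx D)).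
    congr (\det _); rewrite /block_mx hsubmxK; congr col_mx; apply/rowP => k.
    rewrite [RHS]mxE; case: splitP => j kj; rewrite !mxE.
      by rewrite !ord1 eqxx (_ : k = 0) //; apply: val_inj; rewrite /= kj ord1.
    by rewrite (_ : k == 0 = false) // -(inj_eq val_inj) /= kj.
  by apply: contraTneq uD => D0; rewrite unitmxE unitfE -E D0 eqxx.
exists (delta_mx 0 0); split.
- split; first by rewrite /dot trmx_delta mul_delta_mx mxE !eqxx.
  move=> p /sphere_map_base ->; apply/row_freeP.
  have E : D *m (col_mx (0 : 'M[R]_(1, m.+2)) 1%:M *m invmx (rsubmx D)) = 1%:M.
    by rewrite mulmxA -{1}[D]hsubmxK mul_row_col mulmx0 add0r mulmx1 mulmxV.
  by exists (col_mx (0 : 'M[R]_(1, m.+2)) 1%:M *m invmx (rsubmx D)).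
- move=> [p /band_boundary ph /sphere_map_base pE].
  by move: ph; rewrite pE height_base normr0 => lE; have := l_gt0; rewrite -lE ltxx.
- rewrite (_ : sphere_map @^-1` [set delta_mx 0 0] = [set base_point]) ?fsbig_set1 //.
  apply/seteqP; split=> [p /sphere_map_base //|_ ->].
  exact: sphere_map_base_point.
Qed.

End BandMap.

(** * Lengths of curves *)

(** Monotonicity of the integral of nonnegative functions, for a majorant which
    is not assumed to be measurable, as the speed of a curve is only given
    through a choice of a chart at each point. *)
Lemma ge0_integral_mono d (T : measurableType d) (R : realType)
    (mu : {measure set T -> \bar R}) (D1 D2 : set T) (f g : T -> \bar R) :
  D1 `<=` D2 -> (forall x, D1 x -> (0 <= f x)%E) -> (forall x, D2 x -> (0 <= g x)%E) ->
  (forall x, D1 x -> (f x <= g x)%E) ->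
  (\int[mu]_(x in D1) f x <= \int[mu]_(x in D2) g x)%E.
Proof.
move=> D12 f0 g0 fg; rewrite !ge0_integralE //=.
apply: ereal_sup_le => _ [h hf <-]; exists h => // x.
apply: le_trans (hf x) _; rewrite !patchE.
case: ifPn => [/set_mem xD1|_]; first by rewrite mem_set; [exact: fg|exact: D12].
by case: ifPn => // /set_mem; exact: g0.
Qed.

(** The fundamental theorem of calculus applies on compact subintervals of
    ]0, 1[, where the derivative is continuous; the ends are reached by continuity
    of tau. *)
Lemma variation_le_integral (R : realType) (tau v : R -> R) :
  {within `[0, 1], continuous tau} ->
  (forall s, 0 < s < 1 -> derivable tau s 1 /\ {for s, continuous (derive1 tau)}) ->
  (forall s, 0 < s < 1 -> `|(derive1 tau) s| <= v s) ->
  (`|tau 1 - tau 0|%:E <= \int[lebesgue_measure]_(s in `]0%R, 1%R[) (v s)%:E)%E.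
Proof.
move=> /(continuous_within_itvP _ ltr01) [_ tau0 tau1] dtau tauv.
have inner (a b : R) : 0 < a -> a < b -> b < 1 ->
    (`|tau b - tau a|%:E <= \int[lebesgue_measure]_(s in `]0%R, 1%R[) (v s)%:E)%E.
  move=> a0 ab b1.
  have ab01 s : s \in `[a, b] -> 0 < s < 1.
    by rewrite in_itv /= => /andP[sa sb]; apply/andP; split; lra.
  have cd : {within `[a, b], continuous (derive1 tau)}.
    apply: continuous_in_subspaceT => s /set_mem sab.
    by have [] := dtau s (ab01 s sab).
  have ctau s : s \in `[a, b] -> {for s, continuous tau}.
    move=> sab; apply: differentiable_continuous; apply/derivable1_diffP.
    by have [] := dtau s (ab01 s sab).
  have FTC : (\int[lebesgue_measure]_(x in `[a, b]) ((derive1 tau) x)%:E =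
      (tau b)%:E - (tau a)%:E)%E.
    apply: continuous_FTC2 => //; split.
    - move=> s sab; have [] // := dtau s _; apply: ab01.
      exact: subset_itv_oo_cc sab.
    - apply: cvg_at_right_filter; apply: ctau.
      by rewrite in_itv /= lexx ltW.
    - apply: cvg_at_left_filter; apply: ctau.
      by rewrite in_itv /= lexx ltW.
  have /integrableP[md _] :=
    continuous_compact_integrable (@segment_compact R a b) cd.
  rewrite -abse_EFin EFinB -FTC.
  apply: le_trans (le_abse_integral _ _ md) _ => //.
  apply: ge0_integral_mono => //.
  - by move=> s; rewrite /= in_itv /= => /tauv; rewrite lee_fin; apply: le_trans.
  - by move=> s sab; have := tauv s (ab01 s sab); rewrite lee_fin.
apply/lee_addgt0Pr => e e0; have e2 : 0 < e / 2 by lra.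
have [a [a0 a1 ta]] : exists a, [/\ 0 < a, a < 2^-1 & `|tau 0 - tau a| < e / 2].
  near (0 : R)^'+ => a; exists a; split; near: a.
  - exact: nbhs_right_gt.
  - by apply: nbhs_right_lt; lra.
  - by move/cvgrPdist_lt: tau0; apply.
have [b [b0 b1 tb]] : exists b, [/\ 2^-1 < b, b < 1 & `|tau 1 - tau b| < e / 2].
  near (1 : R)^'- => b; exists b; split; near: b.
  - by apply: nbhs_left_gt; lra.
  - exact: nbhs_left_lt.
  - by move/cvgrPdist_lt: tau1; apply.
apply: (@le_trans _ _ (`|tau b - tau a|%:E + e%:E)%E); last first.
  by rewrite leeD2r // inner //; lra.
rewrite -EFinD lee_fin.
have -> : tau 1 - tau 0 = (tau 1 - tau b) + (tau b - tau a) + (tau a - tau 0) by ring.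
apply: le_trans (ler_normD _ _) _; apply: le_trans (lerD (ler_normD _ _) (lexx _)) _.
by rewrite [`|tau a - _|]distrC; lra.
Unshelve. all: by end_near. Qed.

(** * Distances in the band *)

Section BandDistance.
Context {R : realType} {m : nat}.
Variable l : R.
Hypothesis l_gt0 : 0 < l.
Local Notation band := (@band R m l).
Local Notation M := (@band_manifold R m l l_gt0).
Local Notation dom := (@band_dom R m l).
Local Notation chart := (@band_chart R m l).

Variables (g : metric M) (w : band -> R).
Hypothesis gramE : forall i p, gram g i p = warped_gram (w p).
Hypothesis w_ge0 : forall p, 0 <= w p.

Section Curve.
Variable c : R -> M.
Hypothesis c_smooth : smooth_curve c.
Local Notation tau := (fun s => height (c s)).

Lemma chart_coord0 i (p : band) : chart i p 0 0 = l + axis_sign i 0 * height p.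
Proof. by rewrite mxE eqxx. Qed.

(** Near s the height is, up to sign and a constant, the coordinate 0 of one
    chart. *)
Lemma height_curve_smooth s : 0 < s < 1 ->
  derivable tau s 1 /\ {for s, continuous (derive1 tau)}.
Proof.
move=> /andP[s0 s1]; have [cc /(_ (band_chart_at (c s)) 0) sc] := c_smooth.
set i := band_chart_at (c s) in sc; set e : R := axis_sign i 0.
have ci : dom i (c s) by exact: band_dom_chart_at.
have [|U [F [oU Us CF FE]]] := sc s; first by split=> //; rewrite !ltW.
have cs : {for s, continuous c}.
  have s01 : nbhs s (`[0, 1]%classic : set R).
    near=> t; rewrite /= in_itv /=; apply/andP; split; apply: ltW; near: t.
      exact: lt_nbhsr.
    exact: lt_nbhsl.
  have /subspace_continuousP /(_ s) := cc.
  by rewrite (within_interior s01); apply; rewrite /= in_itv /= !ltW.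
have near_F : \forall t \near s, tau t = e * (F t - l).
  have tD : \forall t \near s, dom i (c t).
    by apply: cs; apply: open_nbhs_nbhs; split=> //; exact: band_dom_open.
  have tU : \forall t \near s, U t by exact: open_nbhs_nbhs.
  near=> t; have t01 : 0 <= t <= 1.
    apply/andP; split; apply: ltW; near: t; [exact: lt_nbhsr|exact: lt_nbhsl].
  have /= := FE t _ _; rewrite chart_coord0 => <-.
  - by rewrite addrAC subrr add0r mulrA axis_sign_sq mul1r.
  - by split=> //; near: t.
  - by near: t.
have dF t : U t -> is_derive (t : R) 1 (fun t => e * (F t - l)) (e * 'D_1 F t).
  move=> Ut; have dFt := derivableP (@Ck_derivable R R U F t 1 CF Ut).
  have := is_deriveZ e (is_deriveB dFt (is_derive_cst l t 1)).
  by rewrite subr0.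
have dtau : \forall t \near s, derivable tau t 1 /\ derive1 tau t = e * 'D_1 F t.
  have near_F2 : \forall t \near s, \forall u \near t, tau u = e * (F u - l).
    exact: nbhs_interior near_F.
  have tU : \forall t \near s, U t by exact: open_nbhs_nbhs.
  near=> t; have [||D1 D2] := @near_eq_is_derive R R R (fun t => e * (F t - l)) tau t 1
    (e * 'D_1 F t).
  - have : \forall u \near t, tau u = e * (F u - l) by near: t.
    by apply: filterS => u ->.
  - by apply: dF; near: t.
  - by rewrite derive1E.
have [Ds Es] := nbhs_singleton dtau; split=> //.
rewrite /prop_for /continuous_at Es.
have cG : (fun t : R => e * 'D_1 F t) @ s --> e * 'D_1 F s.
  apply: (@continuous_mulc _ _ e ('D_1 F) s).
  have := Ck_cont (Ck_derive (1 : R) CF 0) Us; exact.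
apply: cvg_trans cG; apply: near_eq_cvg.
by apply: filterS dtau => t [_ ->].
Unshelve. all: by end_near. Qed.

(** The coefficient of the metric on the square of dt is 1. *)
Lemma height_le_speed s : 0 < s < 1 -> `|derive1 tau s| <= speed g c s.
Proof.
move=> s01; have [ds _] := height_curve_smooth s01.
rewrite /speed gramE -sqrtr_sqr ler_wsqrtr // warped_gram_quad.
rewrite (bigD1 0) //= ?eqxx mul1r.
set i := band_chart_at (c s).
have -> : (\row_b derive1 (fun s => chart i (c s) 0 b) s) 0 0 =
    axis_sign i 0 * derive1 tau s.
  rewrite mxE (_ : (fun s => chart i (c s) 0 0) =
    (fun s => l + axis_sign i 0 * height (c s))).
    have := is_deriveD (is_derive_cst l s 1) (is_deriveZ (axis_sign i 0) (derivableP ds)).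
    by rewrite add0r !derive1E => -[_ ->].
  by apply/funext => t; exact: chart_coord0.
rewrite exprMn [axis_sign _ _ ^+ 2]expr2 axis_sign_sq mul1r lerDl.
apply: sumr_ge0 => a _; apply: mulr_ge0; last exact: sqr_ge0.
by case: ifP.
Qed.

Lemma height_le_curve_length :
  (`|height (c 1) - height (c 0)|%:E <= curve_length g c)%E.
Proof.
apply: (@variation_le_integral R tau (speed g c)).
- have [cc _] := c_smooth; apply/subspace_continuousP => s s01.
  have /subspace_continuousP/(_ s s01) cs := cc.
  by apply: cvg_comp cs _; exact: continuous_height.
- exact: height_curve_smooth.
- exact: height_le_speed.
Qed.

End Curve.

Lemma height_le_joined p q L : joined g p q L -> (`|height q - height p|%:E <= L)%E.
Proof.
elim=> [c /height_le_curve_length //|p1 p2 p3 L1 L2 _ H1 _ H2].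
apply: (@le_trans _ _ (`|height p2 - height p1|%:E + `|height p3 - height p2|%:E)%E).
  rewrite -EFinD lee_fin.
  have -> : height p3 - height p1 = (height p2 - height p1) + (height p3 - height p2).
    by ring.
  exact: ler_normD.
exact: leeD.
Qed.

Lemma dist_set_height (A B : set M) (r : R) :
  (forall p q, A p -> B q -> r <= `|height q - height p|) ->
  (r%:E <= dist_set g A B)%E.
Proof.
move=> AB; apply: le_ereal_inf_tmp => _ [p [q [Ap Bq ->]]].
apply: le_ereal_inf_tmp => L /height_le_joined; apply: le_trans.
by rewrite lee_fin AB.
Qed.

End BandDistance.

(** * The profile of constant scalar curvature *)

Section Profile.
Context {R : realType}.
Variable c : R.
Hypothesis c_gt0 : 0 < c.

(** The solution of the Riccati equation h' = - c (1 + h^2) with h(0) = 0; the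
    curvature calls for c = n / 2. *)
Definition profile_slope (s : R) : R := - tan (c * s).

(** The solution C cos (c s)^(2/c) of w' = 2 h w. *)
Definition profile (C s : R) : R := C * expR (2 / c * ln (cos (c * s))).

Let dom : set R := [set s | `|s| < pi / (2 * c)].

Lemma profile_cos_gt0 s : dom s -> 0 < cos (c * s).
Proof.
move=> sd; apply: cos_gt0_pihalf; rewrite -ltr_norml normrM (gtr0_norm c_gt0).
have := sd; rewrite /dom /= ltr_pdivlMr ?mulr_gt0 // => sp.
by rewrite ltr_pdivlMr // mulrC mulrA mulrC; move: sp; rewrite mulrA [_ * 2]mulrC mulrC.
Qed.

Lemma is_derive_scaled (s : R) : is_derive s 1 (fun s => c * s) c.
Proof.
have := is_deriveZ c (is_derive_id s (1 : R)).
by rewrite [X in is_derive _ _ _ X -> _]mulr1.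
Qed.

Lemma is_derive_profile_slope s : dom s ->
  is_derive s 1 profile_slope (- c * (1 + profile_slope s ^+ 2)).
Proof.
move=> sd; have c0 := profile_cos_gt0 sd; have cn := lt0r_neq0 c0.
have := is_deriveN (is_derive_comp1 (is_derive_scaled s) (is_derive_tan cn)).
move/is_derive_eq; apply.
rewrite /profile_slope sqrrN mulNr; congr (- (_ * _)).
by rewrite -exprVn -[RHS]cos2_tan2 // exprVn.
Qed.

Lemma is_derive_profile C s : dom s ->
  is_derive s 1 (profile C) (2 * profile_slope s * profile C s).
Proof.
move=> sd; have c0 := profile_cos_gt0 sd; have cn := lt0r_neq0 c0.
have d1 := is_derive_comp1 (is_derive_scaled s) (is_derive_cos (c * s)).
have d2 := is_derive_comp1 d1 (is_derive1_ln c0).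
have d3 := is_derive_comp1 (is_deriveZ (2 / c) d2) (is_derive_expR _).
have := is_deriveZ C d3; move/is_derive_eq; apply.
rewrite /profile /profile_slope /tan /GRing.scale /=.
by move: (expR _) => E; field; rewrite cn gt_eqF.
Qed.

(** The span of the w h^j is closed under derivation, as the derivatives of w and
    h are polynomials in w and h. *)
Lemma Ck1_profile C k j : Ck1 k dom (fun s => profile C s * profile_slope s ^+ j).
Proof.
have D i s : dom s -> is_derive s 1 (fun s => profile C s * profile_slope s ^+ i)
    (2 * (profile C s * profile_slope s ^+ i.+1) + (- (c * i%:R)) *
     (profile C s * profile_slope s ^+ i.-1 + profile C s * profile_slope s ^+ i.+1)).
  move=> sd; have dw := is_derive_profile C sd; have dh := is_derive_profile_slope sd.
  have := @is_deriveX _ _ _ i _ _ _ dh; rewrite exprfctE => dX.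
  have := is_deriveM dw dX; move/is_derive_eq; apply.
  rewrite /GRing.scale /=; case: i dX => [_|i _]; rewrite /= !exprS; ring.
elim: k j => [|k IH] j.
  move=> s sd; apply: differentiable_continuous; apply/derivable1_diffP.
  by have [] := D j s sd.
exists (fun s => 2 * (profile C s * profile_slope s ^+ j.+1) + (- (c * j%:R)) *
     (profile C s * profile_slope s ^+ j.-1 + profile C s * profile_slope s ^+ j.+1)).
  by move=> s; exact: D.
by apply: Ck1_add; apply: Ck1_scale => //; apply: Ck1_add.
Qed.

Lemma profile_smooth C k : Ck1 k dom (profile C).
Proof.
have := Ck1_profile C k 0.
by rewrite (_ : (fun s => _) = profile C) //; apply/funext => s; rewrite mulr1.
Qed.

Lemma profile_even C s : profile C (- s) = profile C s.
Proof. by rewrite /profile mulrN cosN. Qed.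

Lemma profile_gt0 C s : 0 < C -> 0 < profile C s.
Proof. by move=> C0; rewrite mulr_gt0 ?expR_gt0. Qed.

Lemma profile_large (l K : R) : 0 <= l -> l < pi / (2 * c) ->
  exists2 C, 0 < C & forall s, `|s| <= l -> K <= profile C s.
Proof.
move=> l0 lc; have ll : - l <= l by lra.
have [|s0 _ min] := @EVT_min R (profile 1) (- l) l ll.
  apply: continuous_in_subspaceT => s /set_mem /=; rewrite in_itv /= -ler_norml => sl.
  by apply: (Ck1_cont (profile_smooth 1 0)); exact: le_lt_trans sl lc.
have p0 : 0 < profile 1 s0 by exact: profile_gt0.
exists ((`|K| + 1) / profile 1 s0); first by rewrite divr_gt0 // ltr_wpDl.
move=> s; rewrite ler_norml => sl.
have : profile 1 s0 <= profile 1 s by apply: min; rewrite in_itv.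
have -> : profile ((`|K| + 1) / profile 1 s0) s =
    (`|K| + 1) * (profile 1 s / profile 1 s0).
  by rewrite /profile mul1r; ring.
rewrite -[X in X <= _]mul1r -ler_pdivlMr // => H.
have K1 : 0 <= `|K| + 1 by rewrite addr_ge0.
apply: le_trans (ler_peMr K1 H).
by have := ler_norm K; lra.
Qed.

End Profile.

(** * The band with a long neck *)

Theorem proposition5p2 (R : realType) (n : nat) (hn : (2 <= n)%N)
    (eps l : R) (heps : 0 < eps) (hl0 : 0 < l) (hl : l < pi / n%:R) :
  exists (M : cmanifold R n) (g : metric M) (Phi : M -> 'rV[R]_n.+1),
    [/\ connected [set: M], oriented M, inhabited (spin_structure g)
      & boundary M !=set0] /\
    [/\ smooth_sphere_map Phi, area_nonincreasing Phi g,
        locally_constant_near_boundary Phi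
      & exists2 d : int, d != 0 & has_degree Phi d] /\
    [/\ (forall p : M, scal g p = (n * (n - 1))%:R),
        (forall p : M, boundary M p ->
           mean_curvature g p = - tan (n%:R * l / 2))
      & ((l - eps)%:E <= dist_set g (supp_differential Phi) (boundary M))%E].
Proof.
case: n hn hl => [//|[//|m]] _ hl.
pose delta := Num.min eps l / 2.
have [d0 [dl de]] : 0 < delta /\ delta < l /\ delta <= eps.
  have m0 : 0 < Num.min eps l by rewrite lt_min heps hl0.
  have ml : Num.min eps l <= l by rewrite ge_min lexx orbT.
  have me : Num.min eps l <= eps by rewrite ge_min lexx.
  by rewrite /delta; split; [|split]; lra.
pose c : R := m.+2%:R / 2.
have c0 : 0 < c by rewrite divr_gt0.
have rE : pi / (2 * c) = pi / m.+2%:R by congr (_ / _); rewrite /c; field.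
have lr : l < pi / (2 * c) by rewrite rE.
pose M := @band_manifold R m l hl0; pose Phi := sphere_map delta : M -> _.
(* C is chosen after the bound B on the differential; 1 + K exceeds both of the
   constants needed for the contraction of bivectors. *)
have [B HB] := @differential_bounded R m l hl0 delta d0.
pose K : R := (m.+3%:R * (m.+2 * m.+2)%:R * B ^+ 2) ^+ 2.
have [C C0 HC] := profile_large c0 (1 + K) (ltW hl0) lr.
have K0 : 0 <= K by exact: sqr_ge0.
have dh s := @is_derive_profile_slope R c c0 s.
pose g := @band_metric R m l hl0 (pi / (2 * c)) (profile c C) lr
  (fun s _ => profile_gt0 c s C0) (profile_smooth c0 C).
exists M, g, Phi; split; [split|split; [split|split]].
- exact: band_connected.
- exact: band_oriented.
- by constructor; exact: band_spin.
- exists (band_proj l (l *: delta_mx 0 0)), 0 => //=.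
  have E : height (band_proj l (l *: delta_mx 0 0 : 'rV[R]_m.+2)) = l.
    by rewrite height_proj !mxE !eqxx mulr1 clampE // gtr0_norm.
  by rewrite chart_coord0 /axis_sign /= E hl0 expr1 mulN1r subrr.
- exact: sphere_map_smooth.
- move=> p; apply: ge_ereal_sup => _ [W [Wa Wn ->]]; rewrite lee_fin.
  have KC : 1 + K <= profile c C (height p) by apply: HC; exact: height_le.
  apply: (@bivector_map_contraction R m.+1 m.+3 (profile c C (height p)) B) => //.
  + by apply: le_trans KC; rewrite lerDl.
  + by apply: le_trans KC; rewrite lerDr.
- exact: sphere_map_locally_constant.
- exact: sphere_map_degree.
- move=> p; have [s sl ->] := @band_scal R m l hl0 _ _ _ _ lr
    (fun s _ => profile_gt0 c s C0) (profile_even c C) (profile_smooth c0 C)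
    (fun s => is_derive_profile c0 C (s := s)) dh p.
  rewrite subSS subn0 [in RHS]mulnC natrM.
  have -> : c = m.+2%:R / 2 by [].
  by field.
- move=> p pb; rewrite (@band_mean_curvature R m l hl0 _ _ _ lr
    (fun s _ => profile_gt0 c s C0) (profile_even c C) (profile_smooth c0 C)
    (fun s => is_derive_profile c0 C (s := s)) p pb).
  rewrite /profile_slope opprK mulrN tanN; congr (- tan _).
  by rewrite /c mulrAC.
- apply: (@dist_set_height R m l hl0 g (fun p => profile c C (height p))) => //.
    by move=> p; rewrite ltW // profile_gt0.
  move=> p q /supp_differential_height ph /band_boundary qh.

  have := lerB_dist (height q) (height p); rewrite qh; lra.
Qed.
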